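(* Let $P$ be a propositional proof system containing $\mathrm{LK}_{3/2}$. Let $U, V \subseteq \{0,1\}^*$ be disjoint NP sets such that: (1) the propositional formulas expressing that $U_n \cap V_n = \emptyset$ have P-proofs of size polynomial in $n$; and (2) for every constant $c \geq 1$, for all sufficiently large $n$ there is a probability distribution $\mathbf{D}_n$ on $\{0,1\}^n$ with support $U_n \cup V_n$ such that there is no Boolean circuit $C_n$ of size $n^c$ with \[ \mathrm{Prob}_x\big[(x \in U_n \wedge C_n(x) = 1) \vee (x \in V_n \wedge C_n(x) = 0)\big] \geq 1/2 + n^{-c}, \] where $x$ is sampled according to $\mathbf{D}_n$. Then $P$ does not admit KPT interpolation.
   Context: For $U \subseteq \{0,1\}^*$ and $n \ge 1$, $U_n := U \cap \{0,1\}^n$. TAUT denotes the set of propositional tautologies. $\mathrm{LK}_{3/2}$ is the $\Sigma$-depth $1$ subsystem of the propositional sequent calculus LK; ''$P$ contains $\mathrm{LK}_{3/2}$'' means that $P$ can operate with sequents of $\Sigma$-depth $1$ formulas and every $\mathrm{LK}_{3/2}$-proof is also a $P$-proof. The NP sets are given by p-time relations $U(x,y)$ and $V(x,z)$ (with witness lengths polynomially bounded in $|x|$) such that $x\in U \iff \exists y\, U(x,y)$ and $x \in V \iff \exists z\, V(x,z)$. For each $n$ these relations are translated into polynomial-size propositional formulas (e.g. 3CNFs) $U(x,y)$, $V(x,z)$, where $x$ is an $n$-tuple of atoms for the bits of $x$ and $y$ (resp. $z$) is a tuple of $n^{O(1)}$ atoms for the bits of a witness together with auxiliary bits used in the encoding;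 the formulas expressing $U_n\cap V_n=\emptyset$ are $\neg U(x,y) \vee \neg V(x,z)$ (equivalently $U(x,y)\rightarrow \neg V(x,z)$) with $y,z$ disjoint tuples of atoms. KPT interpolation: a propositional proof system $P$ has KPT interpolation if there are a constant $k \geq 1$ and $k$ polynomial-time functions $f_1(x,z), f_2(x,z,w_1), \dots, f_k(x,z,w_1,\dots,w_{k-1})$ such that whenever $\pi$ is a $P$-proof of a disjunction of the form $A_0(x,y_1) \vee \dots \vee A_{m-1}(x,y_m)$, where $x$ is an $n$-tuple of atoms and $y_1,\dots,y_m$ are disjoint tuples of atoms, then for all $a \in \{0,1\}^n$ and all assignments $b_1,\dots,b_m$ of appropriate lengths the following holds: either $A_{i_1}(a,y_{i_1}) \in \mathrm{TAUT}$ for $i_1 = f_1(a,\pi)$, or, if $A_{i_1}(a,b_{i_1})$ is false, $A_{i_2}(a,y_{i_2}) \in \mathrm{TAUT}$ for $i_2 = f_2(a,\pi,b_{i_1})$, or, if $A_{i_2}(a,b_{i_2})$ is false, ..., or $A_{i_k}(a,y_{i_k}) \in \mathrm{TAUT}$ for $i_k = f_k(a,\pi,b_{i_1},\dots,b_{i_{k-1}})$. *)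

(* Defs.v *)
From Stdlib Require List.
From HB Require Import structures.
From mathcomp Require Import all_boot all_order all_algebra.
From mathcomp Require Import boolp classical_sets reals.

Set Implicit Arguments.
Unset Strict Implicit.
Unset Printing Implicit Defensive.

Import Order.TTheory GRing.Theory Num.Theory.

Notation bits := (seq bool).

(* "Polynomial in n" means at most [pbound c n] for some constant c; every
   polynomial over nat is below one of these, also at n = 0, 1. *)
Definition pbound (c n : nat) : nat := n ^ c + c.

(* Prefix-free (hence injective) codes whose length is linear in the size of
   the object; nesting [enc_list] does not compound the overhead. *)
Definition enc_list (T : Type) (e : T -> bits) (l : seq T) : bits :=
  rcons (flatten [seq true :: e x | x <- l]) false.

Definition enc_nat (n : nat) : bits := rcons (nseq n true) false.
Definition enc_bits : bits -> bits := enc_list (fun b : bool => [:: b]).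
Definition enc_strs : seq bits -> bits := enc_list enc_bits.
Definition enc_nats : seq nat -> bits := enc_list enc_nat.

(* Value of a binary numeral, least significant bit first. *)
Definition nat_of_bits (s : bits) : nat :=
  foldr (fun (b : bool) n => b + n.*2) 0 s.

(* Deterministic Turing machines with one two-way infinite tape. *)

Inductive move := MoveL | MoveN | MoveR.

(* [None] is the blank, [Some (inl b)] the bit b; the other tape symbols are
   [Some (inr g)]. *)
Definition symbol (G : finType) := option (bool + G).

Record TM := MkTM {
  tm_state : finType;
  tm_aux : finType;
  tm_start : tm_state;
  (* [None] is halting *)
  tm_delta : tm_state -> symbol tm_aux ->
             option (tm_state * symbol tm_aux * move) }.

(* The cells to the left of the head are listed from the head outwards; cells
   not listed on either side are blank. *)
Record config (M : TM) := Config {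
  cf_state : tm_state M;
  cf_left : seq (symbol (tm_aux M));
  cf_head : symbol (tm_aux M);
  cf_right : seq (symbol (tm_aux M)) }.

Definition tm_init (M : TM) (w : bits) : config M :=
  let t := [seq Some (inl b) | b <- w] in
  Config (tm_start M) [::] (head None t) (behead t).

Definition tm_step (M : TM) (c : config M) : option (config M) :=
  let: Config q l h r := c in
  if tm_delta q h is Some (q', h', d) then
    Some (match d with
          | MoveL => Config q' (behead l) (head None l) (h' :: r)
          | MoveN => Config q' l h' r
          | MoveR => Config q' (h' :: l) (head None r) (behead r)
          end)
  else None.

(* The halting configuration reached in at most [t] steps, if any. *)
Fixpoint tm_run (M : TM) (t : nat) (c : config M) : option (config M) :=
  if tm_step c is Some c' then
    (if t is t'.+1 then tm_run t' c' else None)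
  else Some c.

Fixpoint leading_bits (G : finType) (s : seq (symbol G)) : bits :=
  if s is Some (inl b) :: s' then b :: leading_bits s' else [::].

(* The output is the block of bits that starts under the head. *)
Definition tm_output (M : TM) (c : config M) : bits :=
  leading_bits (cf_head c :: cf_right c).

Definition polytime (T : Type) (e : T -> bits) (f : T -> bits) : Prop :=
  exists (M : TM) (c : nat), forall x : T,
    exists2 cf : config M,
      tm_run (pbound c (size (e x))) (tm_init M (e x)) = Some cf &
      tm_output cf = f x.

(* Formulas in the De Morgan language; conjunctions and disjunctions have
   arbitrary finite arity, the empty ones being the constants 1 and 0. *)

Inductive formula :=
  | Atom of nat
  | Not of formula
  | And of seq formula
  | Or of seq formula.

Fixpoint eval (v : nat -> bool) (A : formula) : bool :=
  match A with
  | Atom p => v p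
  | Not B => ~~ eval v B
  | And l => all (eval v) l
  | Or l => has (eval v) l
  end.

Definition TAUT (A : formula) : Prop := forall v, eval v A.

Fixpoint atoms (A : formula) : seq nat :=
  match A with
  | Atom p => [:: p]
  | Not B => atoms B
  | And l | Or l => flatten (map atoms l)
  end.

Fixpoint subst (s : nat -> formula) (A : formula) : formula :=
  match A with
  | Atom p => s p
  | Not B => Not (subst s B)
  | And l => And (map (subst s) l)
  | Or l => Or (map (subst s) l)
  end.

Fixpoint enc_form (A : formula) : bits :=
  match A with
  | Atom p => [:: false, false & enc_nat p]
  | Not B => [:: false, true & enc_form B]
  | And l => [:: true, false & enc_list enc_form l]
  | Or l => [:: true, true & enc_list enc_form l]
  end.

(* A_0 \/ ... \/ A_(m-1); a disjunction of a single formula is that formula. *)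
Definition disj (l : seq formula) : formula := if l is [:: A] then A else Or l.

(* The truth assignment sending a tuple of atoms to a tuple of bits. *)
Definition assign (xs : seq nat) (a : bits) (p : nat) : bool :=
  nth false a (index p xs).

(* A(a, y): the constants a are substituted for the atoms xs of A. *)
Definition plug (xs : seq nat) (a : bits) (A : formula) : formula :=
  subst (fun p => if p \in xs then (if assign xs a p then And [::] else Or [::])
                  else Atom p) A.

(* F(xs): the atoms 0, 1, 2, ... of the schematic formula F are replaced by
   the given tuple of atoms. *)
Definition rename (xs : seq nat) (F : formula) : formula :=
  subst (fun p => Atom (nth 0 xs p)) F.

Definition is_lit (A : formula) : bool :=
  match A with Atom _ | Not (Atom _) => true | _ => false end.

Definition is_3clause (A : formula) : bool :=
  if A is Or l then (size l <= 3) && all is_lit l else false.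

Definition is_3CNF (A : formula) : bool :=
  if A is And l then all is_3clause l else false.

(* The classes Sigma_d^{S,t} and Pi_d^{S,t}.  At level 0 both consist of the
   conjunctions and disjunctions of at most t literals.  The bound S on the
   size is not recorded: S will be the size of the proof in which the formula
   occurs.  Negation exchanges the two classes. *)

Definition small (t : nat) (A : formula) : bool :=
  match A with
  | And l | Or l => (size l <= t) && all is_lit l
  | _ => is_lit A
  end.

Inductive Sigma (t : nat) : nat -> formula -> Prop :=
  | Sigma_small A : small t A -> Sigma t 0 A
  | Sigma_or d l : (forall A, List.In A l -> Pi t d A) -> Sigma t d.+1 (Or l)
  | Sigma_not d A : Pi t d A -> Sigma t d (Not A)
  | Sigma_upS d A : Sigma t d A -> Sigma t d.+1 A
  | Sigma_upP d A : Pi t d A -> Sigma t d.+1 A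
with Pi (t : nat) : nat -> formula -> Prop :=
  | Pi_small A : small t A -> Pi t 0 A
  | Pi_and d l : (forall A, List.In A l -> Sigma t d A) -> Pi t d.+1 (And l)
  | Pi_not d A : Sigma t d A -> Pi t d (Not A)
  | Pi_upP d A : Pi t d A -> Pi t d.+1 A
  | Pi_upS d A : Sigma t d A -> Pi t d.+1 A.

Definition Sigma_depth_le (t d : nat) (A : formula) : Prop :=
  Sigma t d A \/ Pi t d A.

(* Sequent calculus LK. *)

(* (Gamma, Delta) stands for Gamma |- Delta. *)
Definition sequent : Type := seq formula * seq formula.

Definition seq_form (S : sequent) : formula := disj (map Not S.1 ++ S.2).

Definition enc_sequent (S : sequent) : bits :=
  enc_list enc_form S.1 ++ enc_list enc_form S.2.

(* [LK_rule prems S]: S follows from prems by one inference.  [LK_struct]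
   comprises exchange, contraction and weakening; the initial sequents
   0 |- and |- 1 are the cases l = [::] of [LK_orL] and [LK_andR]. *)
Inductive LK_rule : seq sequent -> sequent -> Prop :=
  | LK_ax p : LK_rule [::] ([:: Atom p], [:: Atom p])
  | LK_struct G D G' D' : List.incl G G' -> List.incl D D' ->
      LK_rule [:: (G, D)] (G', D')
  | LK_cut G D A : LK_rule [:: (G, A :: D); (A :: G, D)] (G, D)
  | LK_notL G D A : LK_rule [:: (G, A :: D)] (Not A :: G, D)
  | LK_notR G D A : LK_rule [:: (A :: G, D)] (G, Not A :: D)
  | LK_andL G D A l : List.In A l ->
      LK_rule [:: (A :: G, D)] (And l :: G, D)
  | LK_andR G D l :
      LK_rule [seq (G, A :: D) | A <- l] (G, And l :: D)
  | LK_orL G D l :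
      LK_rule [seq (A :: G, D) | A <- l] (Or l :: G, D)
  | LK_orR G D A l : List.In A l ->
      LK_rule [:: (G, A :: D)] (G, Or l :: D).

(* Dag-like derivations of the last line of [D] from the sequents in [H]. *)
Definition LK_derivation (H D : seq sequent) (S : sequent) : Prop :=
  (exists D', D = rcons D' S) /\
  forall (D1 : seq sequent) (T : sequent) (D2 : seq sequent),
    D = D1 ++ T :: D2 ->
    List.In T H \/
    exists2 prems, LK_rule prems T & List.incl prems D1.

Definition enc_derivation : seq sequent -> bits := enc_list enc_sequent.

(* LK_{d+1/2}: all formulas have Sigma-depth at most d, where t is the
   logarithm of the size of the derivation. *)
Definition LK_half_derivation (d : nat) (H D : seq sequent) (S : sequent) :
    Prop :=
  LK_derivation H D S /\
  forall T A, List.In T D -> List.In A (T.1 ++ T.2) ->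
    Sigma_depth_le (trunc_log 2 (size (enc_derivation D))) d A.

(* Propositional proof systems in the sense of Cook and Reckhow, given by
   their p-time relation "pi is a proof of A". *)

Record proof_system := ProofSystem {
  proves : bits -> formula -> bool;
  proves_polytime : polytime
    (fun u : bits * formula => enc_strs [:: u.1; enc_form u.2])
    (fun u => [:: proves u.1 u.2]);
  proves_TAUT : forall A, TAUT A <-> exists pi, proves pi A }.

(* A proof of a sequent is a proof of the disjunction it stands for.
   "P can operate with sequents of Sigma-depth d formulas" means that P-proofs
   can be prolonged, with polynomial overhead, by LK_{d+1/2}-inferences. *)
Definition contains_LK_half (d : nat) (P : proof_system) : Prop :=
  (forall D S, LK_half_derivation d [::] D S ->
     proves P (enc_derivation D) (seq_form S)) /\
  exists c : nat, forall (ps : seq (bits * sequent)) D S,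
    (forall p, List.In p ps -> proves P p.1 (seq_form p.2)) ->
    LK_half_derivation d (map snd ps) D S ->
    exists2 pi : bits, proves P pi (seq_form S) &
      size pi <= pbound c (sumn [seq size p.1 | p <- ps]
                           + size (enc_derivation D)).

Definition contains_LK32 : proof_system -> Prop := contains_LK_half 1.

(* KPT interpolation. *)

Section KPT.

Variables (f : nat -> bits -> bits -> seq bits -> bits).
Variables (a : bits) (z : bits) (xs : seq nat) (Ay : seq (formula * seq nat))
  (bs : seq bits).

(* [kpt_rounds r j ws]: the clauses from i_{j+1} = f_{j+1}(a, z, ws) on, where
   ws lists the earlier b_{i_1}, ..., b_{i_j} and r further ones follow. *)
Fixpoint kpt_rounds (r j : nat) (ws : seq bits) : Prop :=
  let i := nat_of_bits (f j a z ws) in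
  let A := (nth (Or [::], [::]) Ay i).1 in
  let y := (nth (Or [::], [::]) Ay i).2 in
  let b := nth [::] bs i in
  i < size Ay /\
  (TAUT (plug xs a A) \/
   if r is r'.+1 then
     eval (assign (xs ++ y) (a ++ b)) A = false ->
     kpt_rounds r' j.+1 (rcons ws b)
   else False).

End KPT.

(* The second argument of the functions f_j: the proof pi, as a proof of a
   disjunction displayed in the form A_0(x, y_1) \/ ... \/ A_(m-1)(x, y_m).
   The display has to be part of the input because pi alone does not tell
   which atoms form the tuple x, and in which order. *)
Definition displayed_proof (pi : bits) (xs : seq nat)
    (Ay : seq (formula * seq nat)) : bits :=
  enc_strs [:: pi, enc_nats xs &
            flatten [seq [:: enc_form u.1; enc_nats u.2] | u <- Ay]].

(* f j is the function f_{j+1}(x, z, w_1, ..., w_j); indices i are output in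
   binary. *)
Definition KPT_interpolation (P : proof_system) : Prop :=
  exists (k : nat) (f : nat -> bits -> bits -> seq bits -> bits),
    [/\ 1 <= k,
        forall j, j < k ->
          polytime (fun u : bits * bits * seq bits =>
                      enc_strs [:: u.1.1, u.1.2 & u.2])
                   (fun u => f j u.1.1 u.1.2 u.2)
      & forall (pi : bits) (xs : seq nat) (Ay : seq (formula * seq nat)),
          uniq (xs ++ flatten (map snd Ay)) ->
          (forall u, List.In u Ay -> {subset atoms u.1 <= xs ++ u.2}) ->
          proves P pi (disj (map fst Ay)) ->
          forall (a : bits) (bs : seq bits),
            size a = size xs ->
            map size bs = [seq size u.2 | u <- Ay] ->
            kpt_rounds f a (displayed_proof pi xs Ay) xs Ay bs k.-1 0 [::] ].

(* NP sets and their propositional translations. *)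

Definition NP_given_by (U : set bits) (R : bits -> bits -> bool) : Prop :=
  [/\ polytime (fun u : bits * bits => enc_strs [:: u.1; u.2])
               (fun u => [:: R u.1 u.2]),
      exists c : nat, forall x y, R x y -> size y <= pbound c (size x)
    & forall x, U x <-> exists y, R x y].

(* F n is a 3CNF in which the atoms 0, ..., n-1 stand for x and the next [l n]
   ones for y.  [wit n] reads the witness off the bits of y, the remaining
   bits being auxiliary. *)
Definition translates (R : bits -> bits -> bool) (l : nat -> nat)
    (F : nat -> formula) : Prop :=
  [/\ exists c : nat, forall n,
        l n <= pbound c n /\ size (enc_form (F n)) <= pbound c n,
      forall n, is_3CNF (F n) /\ {subset atoms (F n) <= iota 0 (n + l n)}
    & exists wit : nat -> bits -> bits, forall n a w, size a = n ->
        (R a w <-> exists b : bits,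
           [/\ size b = l n, wit n b = w & eval (nth false (a ++ b)) (F n)])].

(* ~ U(x, y) \/ ~ V(x, z) *)
Definition disjointness_formula (FU FV : formula) (x y z : seq nat) : formula :=
  disj [:: Not (rename (x ++ y) FU); Not (rename (x ++ z) FV)].

Definition short_disjointness_proofs (P : proof_system)
    (lU lV : nat -> nat) (FU FV : nat -> formula) : Prop :=
  exists c : nat, forall (n : nat) (x y z : seq nat),
    size x = n -> size y = lU n -> size z = lV n -> uniq (x ++ y ++ z) ->
    let A := disjointness_formula (FU n) (FV n) x y z in
    (* The size of A, which is polynomial in n, takes account of the length of
       the names of the atoms. *)
    exists2 pi : bits, proves P pi A &
      size pi <= pbound c (n + size (enc_form A)).

(* Boolean circuits with n inputs: wires 0, ..., n-1 are the inputs and wire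
   n + i is the i-th gate.  The size is the number of gates. *)

Inductive gate :=
  | GConst of bool
  | GNot of nat
  | GAnd of nat & nat
  | GOr of nat & nat.

Record circuit := Circuit { gates : seq gate; out_wire : nat }.

Definition gate_wf (bound : nat) (g : gate) : bool :=
  match g with
  | GConst _ => true
  | GNot i => i < bound
  | GAnd i j | GOr i j => (i < bound) && (j < bound)
  end.

Definition circuit_wf (n : nat) (C : circuit) : bool :=
  (out_wire C < n + size (gates C)) &&
  all (fun i => gate_wf (n + i) (nth (GConst false) (gates C) i))
      (iota 0 (size (gates C))).

Definition gate_val (w : bits) (g : gate) : bool :=
  match g with
  | GConst b => b
  | GNot i => ~~ nth false w i
  | GAnd i j => nth false w i && nth false w j
  | GOr i j => nth false w i || nth false w j
  end.

Definition circuit_eval (C : circuit) (x : bits) : bool :=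
  nth false (foldl (fun w g => rcons w (gate_val w g)) x (gates C))
      (out_wire C).

Definition circuit_size (C : circuit) : nat := size (gates C).

Local Open Scope ring_scope.

Definition distribution_on (R : realType) (T : finType) (S : set T)
    (D : {ffun T -> R}) : Prop :=
  [/\ forall x, 0 <= D x, \sum_x D x = 1 & [set x | D x != 0]%classic = S].

Definition Prob (R : realType) (T : finType) (D : {ffun T -> R})
    (E : set T) : R :=
  \sum_(x | `[< E x >]) D x.

Definition hard_to_distinguish (R : realType) (U V : set bits) : Prop :=
  forall c : nat, (1 <= c)%N ->
  exists n0 : nat, forall n : nat, (n0 <= n)%N ->
  exists D : {ffun n.-tuple bool -> R},
    distribution_on [set x : n.-tuple bool | U x \/ V x]%classic D /\
    ~ exists C : circuit,
        [/\ circuit_wf n C, (circuit_size C <= n ^ c)%N &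
            Prob D [set x : n.-tuple bool |
                      (U x /\ circuit_eval C x = true) \/
                      (V x /\ circuit_eval C x = false)]%classic
            >= 2^-1 + (n%:R ^+ c)^-1].

(* Main.v *)
(* Put w = k + 4 strings x_0, ..., x_(w-1) side by side. For every i < 2^w let N_i be
   the NP statement [for some j, x_j lies in V if the j-th bit of i is 1, and in U
   if it is 0]. Reading membership in U as the value 1, N_i says that the values of the
   strings differ from the bits of i, so the N_i cannot all hold. This only uses that
   U and V are disjoint at each length, and P refutes the conjunction of the N_i in
   polynomial size: with selector atoms for j, N_i is a CNF of clauses of width at
   most w, and all formulas of the refutation have depth 1.

   KPT interpolation for the disjunction of the negated N_i gives a student who, in k
   rounds, names the i made of the values of x_0, ..., x_(w-1). The teacher refutes a
   wrong i by a witness for the first x_j on which i errs. The student survives round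
   t without winning as long as his query errs on one of x_0, ..., x_t. Until then
   only witnesses for x_0, ..., x_(t-1) have been revealed, so if the other strings are
   fixed the bit t of his query is a guess of the value of x_t computed by a circuit of
   polynomial size, with the fixed witnesses as advice. By hardness it is right with
   probability at most 1/2 + eps, hence the k rounds all fail with probability at least
   2^-k - 2 eps > 0 over independent x_j, which contradicts interpolation. *)

From HB Require Import structures.
Require Import Defs.
From mathcomp Require Import all_boot all_order all_algebra.
From mathcomp Require Import boolp classical_sets reals.
From mathcomp Require Import zify ring lra.

Set Implicit Arguments.
Unset Strict Implicit.
Unset Printing Implicit Defensive.

HB.instance Definition _ := gen_eqMixin formula.

Lemma InP (T : eqType) (x : T) s : List.In x s <-> x \in s.
Proof.
elim: s => //= y s IHs; rewrite inE IHs; split.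
  by case=> [->|->]; rewrite ?eqxx ?orbT.
by case/orP=> [/eqP->|]; [left | right].
Qed.

(** * Polynomial bounds *)

(** The base is at least 2 for every [n], so the exponent absorbs constants and sums also at [n = 0]
    and [n = 1]. *)
Definition poly_bounded (g : nat -> nat) :=
  exists c, forall n, g n <= n.+2 ^ c.

Lemma poly_bounded_le g h :
  (forall n, g n <= h n) -> poly_bounded h -> poly_bounded g.
Proof. by move=> gh [c hc]; exists c => n; apply: leq_trans (gh n) _. Qed.

Lemma poly_bounded_const a : poly_bounded (fun=> a).
Proof.
by exists a => n; rewrite ltnW // ltn_expl.
Qed.

Lemma poly_bounded_id : poly_bounded id.
Proof. by exists 1 => n; rewrite expn1; lia. Qed.

Lemma poly_bounded_mul g h : poly_bounded g -> poly_bounded h ->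
  poly_bounded (fun n => g n * h n).
Proof. by case=> a ga [b hb]; exists (a + b) => n; rewrite expnD leq_mul. Qed.

Lemma poly_bounded_add g h : poly_bounded g -> poly_bounded h ->
  poly_bounded (fun n => g n + h n).
Proof.
case=> a ga [b hb]; exists (a + b).+1 => n; rewrite expnS.
have ea : n.+2 ^ a <= n.+2 ^ (a + b) by rewrite leq_exp2l // leq_addr.
have eb : n.+2 ^ b <= n.+2 ^ (a + b) by rewrite leq_exp2l // leq_addl.
by move: (ga n) (hb n) ea eb; set u := _ ^ (a + b); nia.
Qed.

Lemma poly_bounded_exp g c :
  poly_bounded g -> poly_bounded (fun n => g n ^ c).
Proof.
case=> a ga; exists (a * c) => n; rewrite expnM.
by case: c => [|c]; rewrite ?expn0 // leq_exp2r.
Qed.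

Lemma poly_bounded_pbound c g : poly_bounded g ->
  poly_bounded (fun n => pbound c (g n)).
Proof.
move=> hg; apply: poly_bounded_add; last exact: poly_bounded_const.
exact: poly_bounded_exp.
Qed.

(** Since [n.+2 <= n ^ 2] for [n > 1], doubling the exponent gives the form [n ^ c] in which
    hardness bounds circuits. *)
Lemma poly_bounded_expn g : poly_bounded g ->
  exists c, forall n, 1 < n -> g n <= n ^ c.
Proof.
case=> c gc; exists (2 * c) => n n1; apply: leq_trans (gc n) _.
by rewrite expnM; case: c {gc} => [|c]; rewrite ?expn0 // leq_exp2r //; nia.
Qed.

Lemma size_enc_list T (e : T -> bits) l :
  size (enc_list e l) = (sumn [seq (size (e x)).+1 | x <- l]).+1.
Proof.
rewrite /enc_list size_rcons size_flatten /shape -map_comp.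
by congr _.+1; congr sumn; apply: eq_map.
Qed.

Lemma sumn_map_le (T : eqType) (g : T -> nat) l B :
  (forall x, x \in l -> g x <= B) -> sumn [seq g x | x <- l] <= size l * B.
Proof.
elim: l => //= x l IHl gB; rewrite mulSn leq_add ?gB ?mem_head //.
by apply: IHl => y yl; rewrite gB // inE yl orbT.
Qed.

Lemma size_enc_list_le (T : eqType) (e : T -> bits) l B :
  (forall x, x \in l -> size (e x) <= B) ->
  size (enc_list e l) <= (size l * B.+1).+1.
Proof. by move=> eB; rewrite size_enc_list ltnS; apply: sumn_map_le. Qed.

Lemma size_enc_nat n : size (enc_nat n) = n.+1.
Proof. by rewrite size_rcons size_nseq. Qed.

Lemma size_enc_bits b : size (enc_bits b) = (2 * size b).+1.
Proof. by rewrite size_enc_list /=; congr _.+1; elim: b => //= x b ->; lia. Qed.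
(** * Circuits *)

Definition wires (gs : seq gate) (x : bits) : bits :=
  foldl (fun w g => rcons w (gate_val w g)) x gs.

Definition gates_wf (n : nat) (gs : seq gate) : bool :=
  all (fun i => gate_wf (n + i) (nth (GConst false) gs i)) (iota 0 (size gs)).

Definition on_wire (n : nat) (gs : seq gate) (f : bits -> bool) : Prop :=
  exists2 i, i < n + size gs &
    forall x, size x = n -> nth false (wires gs x) i = f x.

Lemma wires_rcons gs g x :
  wires (rcons gs g) x = rcons (wires gs x) (gate_val (wires gs x) g).
Proof. by rewrite /wires foldl_rcons. Qed.

Lemma size_wires gs x : size (wires gs x) = size x + size gs.
Proof.
elim/last_ind: gs => [|gs g IHgs]; first by rewrite addn0.
by rewrite wires_rcons !size_rcons IHgs addnS.
Qed.

Lemma gates_wf_rcons n gs g :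
  gates_wf n (rcons gs g) = gates_wf n gs && gate_wf (n + size gs) g.
Proof.
rewrite /gates_wf size_rcons -addn1 iotaD all_cat /= andbT nth_rcons ltnn eqxx.
congr andb; apply: eq_in_all => i; rewrite mem_iota => /= ilt.
by rewrite nth_rcons ilt.
Qed.

Lemma on_wire_rcons n gs g f : on_wire n gs f -> on_wire n (rcons gs g) f.
Proof.
case=> i ilt fi; exists i; first by rewrite size_rcons addnS ltnS ltnW.
by move=> x sx; rewrite wires_rcons nth_rcons size_wires sx ilt fi.
Qed.

Lemma on_wire_cat n gs gs' f : on_wire n gs f -> on_wire n (gs ++ gs') f.
Proof.
elim/last_ind: gs' => [|gs' g IHgs] fi; first by rewrite cats0.
by rewrite -rcons_cat; apply/on_wire_rcons/IHgs.
Qed.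

Lemma on_wire_ext n gs f g : (forall x, size x = n -> f x = g x) ->
  on_wire n gs f -> on_wire n gs g.
Proof. by move=> fg [i ilt fi]; exists i => // x sx; rewrite fi ?fg. Qed.

Lemma on_wire_input n gs j : j < n -> on_wire n gs (fun x => nth false x j).
Proof. by move=> jn; apply: (@on_wire_cat _ [::]); exists j; rewrite ?addn0. Qed.

Lemma on_wire_gate n gs g : on_wire n (rcons gs g) (fun x => gate_val (wires gs x) g).
Proof.
exists (n + size gs); first by rewrite size_rcons addnS.
by move=> x sx; rewrite wires_rcons nth_rcons size_wires sx ltnn eqxx.
Qed.

(* Shannon expansion on the first argument. *)
Lemma shannon_gates n (fs : seq (bits -> bool)) (h : seq bool -> bool) gs :
  gates_wf n gs -> (forall f, List.In f fs -> on_wire n gs f) ->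
  exists gs', [/\ gates_wf n (gs ++ gs'), size gs' <= 5 * 2 ^ size fs - 4 &
    on_wire n (gs ++ gs') (fun x => h [seq f x | f <- fs])].
Proof.
elim: fs h gs => [|f fs IHfs] h gs wf fsP.
  exists [:: GConst (h [::])]; rewrite cats1 gates_wf_rcons wf; split=> //.
  exact: on_wire_gate.
have fsP' g : List.In g fs -> on_wire n gs g by move=> gfs; apply: fsP; right.
have [gs1 [wf1 size1 w1]] := IHfs (fun s => h (true :: s)) gs wf fsP'.
have [||gs2 [wf2 size2 w2]] := IHfs (fun s => h (false :: s)) (gs ++ gs1) => //.
  by move=> g /fsP'; apply: on_wire_cat.
rewrite -catA in wf2 w2.
have {w1}[i1 lt1 w1] : on_wire n (gs ++ (gs1 ++ gs2)) (fun x => h (true :: map (@^~ x) fs)).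
  by rewrite catA; apply: on_wire_cat.
have [i0 lt0 w0] : on_wire n (gs ++ (gs1 ++ gs2)) f.
  by apply: on_wire_cat; apply: fsP; left.
case: w2 => i2 lt2 w2.
set G := gs ++ (gs1 ++ gs2) in wf2 w2 w1 w0 lt1 lt0 lt2.
set N := n + size G in lt1 lt0 lt2.
(* The last four gates select between the two branches according to [f]. The count closes since
   [2 * (5 * s - 4) + 4 = 5 * (2 * s) - 4] for [s = 2 ^ size fs]. *)
exists (gs1 ++ gs2 ++ [:: GAnd i0 i1; GNot i0; GAnd N.+1 i2; GOr N N.+2]).
have -> : gs ++ gs1 ++ gs2 ++ [:: GAnd i0 i1; GNot i0; GAnd N.+1 i2; GOr N N.+2]
  = rcons (rcons (rcons (rcons G (GAnd i0 i1)) (GNot i0)) (GAnd N.+1 i2)) (GOr N N.+2).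
  by rewrite -!cats1 /G -!catA.
split.
- rewrite !gates_wf_rcons wf2 !size_rcons /=; rewrite -/N; lia.
- by rewrite !size_cat /= expnS; have := expn_gt0 2 (size fs); lia.
apply: on_wire_ext (on_wire_gate _ _ _) => x sx /=.
have sG : size (wires G x) = N by rewrite size_wires sx.
rewrite !wires_rcons /= !nth_rcons !size_rcons !sG w1 // w0 // w2 // ltnn eqxx.
rewrite ltnS leqnn ltnn eqxx.
have lt2' : i2 < N.+1 by lia.
rewrite lt2' lt0 lt2 !eqxx.
by rewrite leqnSn !ltnn; case: (f x); rewrite /= ?orbF.
Qed.

(** One gate list serves the whole family, so shared subcircuits are paid for once. *)
Definition computed (n s : nat) (F : (bits -> bool) -> Prop) : Prop :=
  exists gs, [/\ gates_wf n gs, size gs <= s & forall f, F f -> on_wire n gs f].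

(** Dependence is expressed by agreement of values, without naming a function that combines them;
    [computed_add] recovers one by choice. *)
Definition local_in (X W : Type) (n m : nat) (F : (bits -> X) -> Prop)
    (g : bits -> W) : Prop :=
  exists fs : seq (bits -> X),
    [/\ size fs <= m, forall f, List.In f fs -> F f &
        forall x y, size x = n -> size y = n ->
          (forall f, List.In f fs -> f x = f y) -> g x = g y].

Lemma computed_sub n s (F F' : (bits -> bool) -> Prop) :
  (forall f, F' f -> F f) -> computed n s F -> computed n s F'.
Proof. by move=> sub [gs [wf sgs Fgs]]; exists gs; split=> // f /sub /Fgs. Qed.

Lemma eq_map_In (T1 T2 : Type) (f g : T1 -> T2) s x :
  map f s = map g s -> List.In x s -> f x = g x.
Proof. by elim: s => //= y s IHs [fgy /IHs IH] [<-|/IH]. Qed.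

(** Each member of [gl] is a Boolean function of at most [m] wires that exist already, so Shannon
    expansion adds it for [5 * 2 ^ m] gates. *)
Lemma computed_add n s m F (gl : seq (bits -> bool)) : computed n s F ->
  (forall g, List.In g gl -> local_in n m F g) ->
  computed n (s + size gl * (5 * 2 ^ m)) (fun f => F f \/ List.In f gl).
Proof.
move=> cF; elim: gl => [|g gl IHgl] glF.
  by rewrite addn0; apply: computed_sub cF => f [].
have [|gs [wf sgs Fgs]] := IHgl; first by move=> g' g'gl; apply: glF; right.
have [fs [sfs fsF gE]] : local_in n m F g by apply: glF; left.
(* [h] evaluates [g] at an arbitrary input showing the values [s]; by locality the choice is
   immaterial. *)
pose h s := g (xget [::] [set x : bits | size x = n /\ [seq f x | f <- fs] = s]).
have [|gs' [wf' sgs' w']] := @shannon_gates n fs h gs wf.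
  by move=> f /fsF Ff; apply: Fgs; left.
exists (gs ++ gs'); split=> //.
  have : 2 ^ size fs <= 2 ^ m by rewrite leq_exp2l.
  by rewrite size_cat /= mulSn; lia.
move=> f [Ff|[<-|fgl]].
- by apply: on_wire_cat; apply: Fgs; left.
- apply: on_wire_ext w' => x sx; rewrite /h; case: xgetP => [y _ [sy fxy]|/(_ x)].
    by apply: gE => // f'; exact: (eq_map_In (f := @^~ y) (g := @^~ x)).
  by case.
by apply: on_wire_cat; apply: Fgs; right.
Qed.

Lemma computed_inputs n :
  computed n 0 (fun f => exists2 j, j < n & f = fun x => nth false x j).
Proof. by exists [::]; split=> // f [j jn ->]; apply: on_wire_input. Qed.

(** * Functions with values in a finite type, carried by one wire per value *)

Section FiniteValues.

Variable V : finType.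

Definition indicators (F : (bits -> V) -> Prop) (f : bits -> bool) : Prop :=
  exists v e, F v /\ f = (fun x => v x == e).

Fixpoint one_hot (fs : seq (bits -> V)) : seq (bits -> bool) :=
  if fs is f :: fs' then [seq (fun x => f x == e) | e <- enum V] ++ one_hot fs'
  else [::].

Lemma size_one_hot fs : size (one_hot fs) = size fs * #|V|.
Proof. by elim: fs => //= f fs IHfs; rewrite size_cat size_map -cardE IHfs. Qed.

Lemma In_map_seq (T1 T2 : Type) (h : T1 -> T2) s y :
  List.In y (map h s) <-> exists2 x, List.In x s & y = h x.
Proof.
elim: s => [|z s IHs] /=; first by split=> // -[].
rewrite IHs; split=> [[<-|[x xs ->]]|[x [->|xs] ->]].
- by exists z => //; left.
- by exists x => //; right.
- by left.
by right; exists x.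
Qed.

Lemma In_one_hot fs g : List.In g (one_hot fs) <->
  exists f e, List.In f fs /\ g = (fun x => f x == e).
Proof.
elim: fs => [|f fs IHfs] /=; first by split=> // -[? [? []]].
rewrite List.in_app_iff In_map_seq IHfs; split.
  case=> [[e _ ->]|[f' [e [f'fs ->]]]]; first by exists f, e; split=> //; left.
  by exists f', e; split=> //; right.
case=> f' [e [[<-|f'fs] ->]]; last by right; exists f', e.
by left; exists e => //; apply/InP; rewrite mem_enum.
Qed.

Lemma one_hot_eq fs f x y : List.In f fs ->
  (forall g, List.In g (one_hot fs) -> g x = g y) -> f x = f y.
Proof.
move=> ffs /(_ (fun z => f z == f y)) E; apply/eqP; rewrite E ?eqxx //.
by apply/In_one_hot; exists f, (f y).
Qed.

Lemma local_in_indicators (W : Type) n m F (g : bits -> W) :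
  local_in n m F g -> local_in n (m * #|V|) (indicators F) g.
Proof.
case=> fs [sfs fsF gfs]; exists (one_hot fs); split.
- by rewrite size_one_hot leq_mul2r sfs orbT.
- by move=> f /In_one_hot[v [e [/fsF Fv ->]]]; exists v, e.
by move=> x y sx sy xy; apply: gfs => // f ffs; apply: one_hot_eq xy.
Qed.

Lemma computed_indicators n s m (F : (bits -> bool) -> Prop) gl :
  computed n s F -> (forall g : bits -> V, List.In g gl -> local_in n m F g) ->
  computed n (s + size gl * #|V| * (5 * 2 ^ m)) (indicators (fun v => List.In v gl)).
Proof.
move=> cF glF; rewrite -size_one_hot; apply: computed_sub (computed_add cF _).
  by move=> f [v [e [vgl ->]]]; right; apply/In_one_hot; exists v, e.
move=> f /In_one_hot[v [e [/glF[fs [sfs fsF vfs]] ->]]].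
by exists fs; split=> // x y sx sy xy; rewrite (vfs x y).
Qed.

End FiniteValues.

Section Simulation.

Variable M : TM.

Notation sym := (option (bool + tm_aux M)).
Notation val := (tm_state M + sym)%type.

(** * Circuits for Turing machines *)

(** Cells are addressed by their distance from the head. The head thus stays in place while the tape
    shifts, and the new content of a cell depends on a bounded number of old ones, whatever the
    position of the head. *)
Inductive cell := CState | CHead | CLeft of nat | CRight of nat.

Definition cell_val (c : config M) (p : cell) : val :=
  match p with
  | CState => inl (cf_state c)
  | CHead => inr (cf_head c)
  | CLeft i => inr (nth None (cf_left c) i)
  | CRight i => inr (nth None (cf_right c) i)
  end.

(** At most five cells. For [i = 0] the entry [i.-1] merely repeats cell 0: what is shifted into
    that place comes from the head, which is in the list. *)
Definition neighbours (p : cell) : seq cell :=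
  [:: CState, CHead & match p with
    | CState => [::]
    | CHead => [:: CLeft 0; CRight 0]
    | CLeft i => [:: CLeft i.-1; CLeft i; CLeft i.+1]
    | CRight i => [:: CRight i.-1; CRight i; CRight i.+1]
    end].

Definition total_step (c : config M) : config M := odflt c (tm_step c).

(** Halting configurations are fixed points of [total_step], so the circuits may iterate exactly [t]
    times without watching for the halt. *)
Lemma tm_run_iter t c cf : tm_run t c = Some cf -> iter t total_step c = cf.
Proof.
elim: t c => [|t IHt] c /=; first by case: tm_step => // -[].
case E: (tm_step c) => [c'|]; first by move/IHt; rewrite -iterS iterSr /total_step E.
case=> <-; have fixc : total_step c = c by rewrite /total_step E.
by rewrite -iterS; elim: t.+1 => //= t' ->.
Qed.

(** The state and the scanned symbol decide the move; each cell then keeps its content, takes that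
    of an adjacent cell, or takes the written symbol. *)
Lemma total_step_local c c' p :
  (forall q, List.In q (neighbours p) -> cell_val c q = cell_val c' q) ->
  cell_val (total_step c) p = cell_val (total_step c') p.
Proof.
case: c c' => [s l h r] [s' l' h' r'] nbr.
have [Es] := nbr CState (or_introl erefl).
have [Eh] := nbr CHead (or_intror (or_introl erefl)).
have nbr2 q : List.In q (behead (behead (neighbours p))) ->
  cell_val (Config s l h r) q = cell_val (Config s' l' h' r') q.
  by move=> qp; apply: nbr; right; right.
move: nbr2; rewrite /total_step {nbr} /= Es Eh.
case E: (tm_delta s' h') => [[[s1 h1] d]|] /=; last first.
  case: p => [||i|i] /= nbr; rewrite ?Es ?Eh //.
    by apply: (nbr (CLeft i)); right; left.
  by apply: (nbr (CRight i)); right; left.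
case: p => [||i|i] /= nbr.
- by case: d {E}.
- have [El] := nbr (CLeft 0) (or_introl erefl).
  have [Er] := nbr (CRight 0) (or_intror (or_introl erefl)).
  by case: d {E} => //=; rewrite -!nth0 ?El ?Er.
- have [E0] := nbr (CLeft i.-1) (or_introl erefl).
  have [E1] := nbr (CLeft i) (or_intror (or_introl erefl)).
  have [E2] := nbr (CLeft i.+1) (or_intror (or_intror (or_introl erefl))).
  case: d {E} => /=; rewrite ?nth_behead ?E1 ?E2 //.
  by case: i E0 {E1 E2 nbr} => //= i ->.
- have [E0] := nbr (CRight i.-1) (or_introl erefl).
  have [E1] := nbr (CRight i) (or_intror (or_introl erefl)).
  have [E2] := nbr (CRight i.+1) (or_intror (or_intror (or_introl erefl))).
  case: d {E} => /=; rewrite ?nth_behead ?E1 ?E2 //.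
  by case: i E0 {E1 E2 nbr} => //= i ->.
Qed.

Definition cells (b : nat) : seq cell :=
  [:: CState, CHead & map CLeft (iota 0 b) ++ map CRight (iota 0 b)].

Lemma size_cells b : size (cells b) = (2 * b).+2.
Proof. by rewrite /= size_cat !size_map size_iota; lia. Qed.

Lemma In_cells b p : List.In p (cells b) <->
  match p with CLeft i | CRight i => i < b | _ => True end.
Proof.
rewrite /= List.in_app_iff !In_map_seq; case: p => [||i|i]; split; try by [].
- by left.
- by right; left.
- by case=> // -[//|[] [j /InP + []]] => [+ ->|//]; rewrite mem_iota.
- by move=> ib; right; right; left; exists i => //; apply/InP; rewrite mem_iota.
- by case=> // -[//|[] [j /InP + []]] => [//|+ ->]; rewrite mem_iota.
- by move=> ib; right; right; right; exists i => //; apply/InP; rewrite mem_iota.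
Qed.

Lemma neighbours_cells b p q :
  List.In p (cells b) -> List.In q (neighbours p) -> List.In q (cells b.+1).
Proof.
rewrite !In_cells; case: p => [||i|i] /= pb.
- by do 2?[case=> [<-//|]].
- by do 4?[case=> [<-//|]].
- by do 5?[case=> [<-//|]] => //; lia.
- by do 5?[case=> [<-//|]] => //; lia.
Qed.

Variables (n L : nat) (u : bits -> bits).

Hypothesis size_u : forall x, size x = n -> size (u x) = L.

Definition inputs (f : bits -> bool) : Prop :=
  exists2 j, j < n & f = fun x => nth false x j.

Hypothesis bit_u :
  forall p, p < L -> local_in n 1 inputs (fun x => nth false (u x) p).

Definition cell_at (i : nat) (p : cell) (x : bits) : val :=
  cell_val (iter i total_step (tm_init M (u x))) p.

(** The price of one cell at one time: one wire per value, each a Boolean function of the indicators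
    of five cells. *)
Definition cell_cost : nat := #|{: val}| * (5 * 2 ^ (5 * #|{: val}|)).

Lemma cell_at_init p : local_in n 1 inputs (cell_at 0 p).
Proof.
have tape i : local_in n 1 inputs
    (fun x => nth None [seq Some (inl b) : sym | b <- u x] i).
  have [iL|Li] := ltnP i L.
    have [fs [sfs fsF fsu]] := bit_u iL; exists fs; split=> // x y sx sy xy.
    by rewrite !(nth_map false) ?size_u // (fsu x y).
  exists [::]; split=> // x y sx sy _.
  by rewrite !nth_default // size_map size_u.
have lift i (g : bits -> val) :
    (forall x, g x = inr (nth None [seq Some (inl b) : sym | b <- u x] i)) ->
    local_in n 1 inputs g.
  move=> gE; have [fs [sfs fsF fsu]] := tape i; exists fs; split=> //.
  by move=> x y sx sy xy; rewrite !gE (fsu x y).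
case: p => [||i|i].
- by exists [::].
- by apply: (lift 0) => x; rewrite /cell_at /= nth0.
- by exists [::]; split=> // x y _ _ _; rewrite /cell_at /= nth_nil.
- by apply: (lift i.+1) => x; rewrite /cell_at /= nth_behead.
Qed.

Lemma computed_leq n' s s' F : s <= s' -> computed n' s F -> computed n' s' F.
Proof. by move=> ss' [gs [wf sgs FP]]; exists gs; split=> //; apply: leq_trans ss'. Qed.

(** Going back one step widens the window by one cell on each side, so the induction is on [i] for
    all [b]: there are [i.+1] layers, none wider than the initial window of radius [b + i]. *)
Lemma computed_cells i b :
  computed n (i.+1 * (2 * (b + i)).+2 * cell_cost)
    (indicators (fun v => exists2 p, List.In p (cells b) & v = cell_at i p)).
Proof.
have eq_fam i' b' f :
    indicators (fun v => exists2 p, List.In p (cells b') & v = cell_at i' p) f ->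
    indicators (fun v => List.In v [seq cell_at i' p | p <- cells b']) f.
  move=> [v [e [[p pb ->] ->]]]; exists (cell_at i' p), e; split=> //.
  by apply/In_map_seq; exists p.
elim: i b => [|i IHi] b; apply: computed_sub (eq_fam _ _) _.
  have cV : 0 < #|{: val}| by apply/card_gt0P; exists (inl (tm_start M)).
  apply: computed_leq (computed_indicators (computed_inputs n) (m := 1) _).
    rewrite size_map size_cells add0n addn0 mul1n /cell_cost -mulnA.
    by rewrite !leq_mul2l leq_exp2l ?muln_gt0 ?cV ?orbT.
  by move=> g /In_map_seq[p _ ->]; apply: cell_at_init.
apply: computed_leq (computed_indicators (IHi b.+1) (m := 5 * #|{: val}|) _).
  rewrite size_map size_cells -(mulnA (2 * b).+2) -/cell_cost addSnnS.
  by rewrite [i.+2 * _]mulSn mulnDl addnC leq_add2r leq_mul2r; apply/orP; right; lia.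
move=> g /In_map_seq[p pb ->]; apply: local_in_indicators.
exists [seq cell_at i q | q <- neighbours p]; split.
- by case: p {pb}.
- move=> f /In_map_seq[q qp ->]; exists q => //.
  exact: neighbours_cells qp.
move=> x y sx sy xy; rewrite /cell_at !iterS; apply: total_step_local => q qp.
by apply: (xy (cell_at i q)); apply/In_map_seq; exists q.
Qed.

Definition tape_at (i p : nat) (x : bits) : sym :=
  let c := iter i total_step (tm_init M (u x)) in nth None (cf_head c :: cf_right c) p.

Definition numeral_at (i q d : nat) (x : bits) : nat :=
  nat_of_bits (leading_bits [seq tape_at i p x | p <- iota q d]).

Definition numeral_cost : nat := 5 * 2 ^ #|{: val}|.+1.

Lemma tape_at_cell i p :
  cell_at i (if p is p'.+1 then CRight p' else CHead) = fun x => inr (tape_at i p x).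
Proof. by apply/funext => x; case: p. Qed.

(** The least significant bit comes first: it must match the parity of [a], and the rest must denote
    [a./2]. The first symbol that is not a bit ends the numeral, leaving the value 0. *)
Lemma numeral_at_eq i q d x a : (numeral_at i q d.+1 x == a) =
  if tape_at i q x is Some (inl b) then (b == odd a) && (numeral_at i q.+1 d x == a./2)
  else a == 0.
Proof.
rewrite /numeral_at /=; case: tape_at => [[b|g]|] /=; rewrite 1?eq_sym //.
set m := nat_of_bits _; case: b; rewrite /= ?add1n ?add0n; lia.
Qed.

(** The numeral is decoded from its far end. Values up to [I] are closed under halving, so [I.+1]
    wires per position suffice, each reading one wire of the next position and the indicators of one
    symbol. *)
Lemma computed_numerals s i r I q d : q + d = r.+1 ->
  computed n s (indicators (fun v => exists2 p, List.In p (cells r) & v = cell_at i p)) ->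
  computed n (s + d.+1 * (I.+1 * numeral_cost)) (fun f =>
    indicators (fun v => exists2 p, List.In p (cells r) & v = cell_at i p) f \/
    exists2 a, a <= I & f = fun x => numeral_at i q d x == a).
Proof.
set F := indicators _ => qd cF.
pose gl q d := [seq (fun x => numeral_at i q d x == a) | a <- iota 0 I.+1].
have sgl q' d' : size (gl q' d') = I.+1 by rewrite size_map size_iota.
elim: d q qd => [|d IHd] q qd.
- apply: (computed_leq (s := s + size (gl q 0) * (5 * 2 ^ 0))).
    by rewrite sgl leq_add2l !mul1n leq_mul2l leq_mul2l leq_exp2l ?orbT.
  apply: (computed_sub _ (computed_add cF _)).
    move=> f [Ff|[a aI ->]]; [by left | right; apply/In_map_seq].
    by exists a => //; apply/InP; rewrite mem_iota.
  by move=> g /In_map_seq[a _ ->]; exists [::].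
apply: (computed_leq (s := s + d.+1 * (I.+1 * numeral_cost) + size (gl q d.+1) * numeral_cost)).
  by rewrite sgl -addnA leq_add2l -mulSnr.
apply: (computed_sub _ (computed_add (IHd q.+1 _) _)); last 1 first.
- move=> g /In_map_seq[a /InP aI ->].
  exists ((fun x => numeral_at i q.+1 d x == a./2) ::
    one_hot [:: fun x => inr (tape_at i q x) : val]); split.
  + by rewrite /= size_cat size_map -cardE addn0.
  + move=> f [<-|/In_one_hot[v [e [[<-|//] ->]]]].
      by right; exists a./2 => //; move: aI; rewrite mem_iota; lia.
    left; exists (fun x => inr (tape_at i q x)), e; split=> //.
    rewrite -tape_at_cell; exists (if q is p'.+1 then CRight p' else CHead) => //.
    by rewrite In_cells; case: (q) qd => // q'; lia.
  move=> x y sx sy xy; rewrite !numeral_at_eq.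
  have [->] : inr (tape_at i q x) = inr (tape_at i q y) :> val.
    pose v x' : val := inr (tape_at i q x').
    apply: (@one_hot_eq _ [:: v] v x y).
      by left.
    by move=> g1 gq; apply: xy; right.
  by rewrite (xy (fun x => numeral_at i q.+1 d x == a./2)) //; left.
- move=> f [Ff|[a aI ->]]; [by left; left | right; apply/In_map_seq].
  by exists a => //; apply/InP; rewrite mem_iota.
by rewrite addSnnS.
Qed.

Lemma leading_bits_pad (s : seq sym) k : size s <= k ->
  leading_bits [seq nth None s p | p <- iota 0 k] = leading_bits s.
Proof.
elim: s k => [|a s IHs] [|k] //= sk.
by case: a => [[b|]|] //=; rewrite -(IHs k) // -[1]addn0 iotaDl -map_comp.
Qed.

(** Each step lengthens the right part of the tape by at most one cell, so the whole output lies in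
    a window of polynomial width. *)
Lemma size_right_iter i x : size x = n ->
  size (cf_right (iter i total_step (tm_init M (u x)))) <= L + i.
Proof.
move=> sx; elim: i => [|i IHi].
  by rewrite /= size_behead size_map size_u // addn0 leq_pred.
rewrite iterS; case: (iter i _ _) IHi => [q l h r] /=.
rewrite /total_step /=; case: tm_delta => [[[q' h'] d]|] /=; last by lia.
by case: d => /=; rewrite ?size_behead; lia.
Qed.

Definition simulation_cost (I T : nat) : nat :=
  T.+1 * (2 * (L + T + T)).+2 * cell_cost + (L + T).+2 * (I.+1 * numeral_cost).

Lemma computed_tm_output I T a g : a <= I ->
  (forall x, size x = n -> exists2 cf, tm_run T (tm_init M (u x)) = Some cf &
     g x = (nat_of_bits (tm_output cf) == a)) ->
  computed n (simulation_cost I T) (fun f => f = g).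
Proof.
move=> aI gP.
have [|gs [wf sgs gsP]] := computed_numerals (r := L + T) (q := 0) (d := (L + T).+1) I
  _ (computed_cells T (L + T)); first by [].
exists gs; split=> // _ ->; apply: on_wire_ext (gsP _ (or_intror (ex_intro2 _ _ a aI erefl))).
move=> x sx; have [cf /tm_run_iter cfE ->] := gP x sx.
rewrite /numeral_at leading_bits_pad /tm_output ?cfE //=.
by rewrite -cfE ltnS size_right_iter.
Qed.

End Simulation.

(** The exponent depends on the machine, its time bound and the constant [I] only, whereas the map
    [u], into which advice can be wired, may vary with [n]. Only the test whether the output denotes
    [a] is computed. *)
Lemma polytime_circuits (T : Type) (e : T -> bits) (f : T -> bits) I : polytime e f ->
  exists c, forall n L (u : bits -> T) a,
    (forall x, size x = n -> size (e (u x)) = L) ->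
    (forall p, p < L -> local_in n 1 (inputs n) (fun x => nth false (e (u x)) p)) ->
    a <= I ->
    computed n (L.+2 ^ c) (fun g => g = fun x => nat_of_bits (f (u x)) == a).
Proof.
case=> M [c0 Mf]; pose g L := simulation_cost M L I (pbound c0 L).
have [c gc] : poly_bounded g.
  have pT := poly_bounded_pbound c0 poly_bounded_id.
  have pS h : poly_bounded h -> poly_bounded (fun n => (h n).+1).
    move=> ph; apply: (@poly_bounded_le _ (fun n => h n + 1)) => [n|]; first by rewrite addn1.
    exact/poly_bounded_add/poly_bounded_const.
  have pLT := poly_bounded_add poly_bounded_id pT.
  rewrite /g /simulation_cost; apply: poly_bounded_add.
    apply: poly_bounded_mul; last exact: poly_bounded_const.
    apply: poly_bounded_mul; first exact: pS.
    do 2!apply: (pS); apply: poly_bounded_mul; first exact: poly_bounded_const.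
    exact: poly_bounded_add.
  apply: poly_bounded_mul; last exact: poly_bounded_const.
  by do 2!apply: (pS).
exists c => n L u a sizeu bitu aI; apply: computed_leq (gc L) _.
apply: (computed_tm_output (M := M) (u := fun x => e (u x)) sizeu bitu aI) => x sx.
by have [cf] := Mf (u x); rewrite sizeu // => run <-; exists cf.
Qed.

(** * Formulas *)

(** The generated induction principle has no hypotheses for the formulas inside a list; here they
    are carried through membership. *)
Fixpoint formula_nested_ind (Q : formula -> Prop)
    (hA : forall p, Q (Atom p)) (hN : forall A, Q A -> Q (Not A))
    (hC : forall l, (forall A, A \in l -> Q A) -> Q (And l))
    (hD : forall l, (forall A, A \in l -> Q A) -> Q (Or l)) A : Q A :=
  let list_ind := fix list_ind (l : seq formula) : forall B, B \in l -> Q B :=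
    match l return forall B, B \in l -> Q B with
    | [::] => fun B (H : B \in [::]) => False_ind _ (notF H)
    | C :: l' => fun B (H : B \in C :: l') =>
        match predU1P (H : (B == C) || (B \in l')) with
        | or_introl E => eq_ind_r Q (formula_nested_ind hA hN hC hD C) E
        | or_intror H' => list_ind l' B H'
        end
    end in
  match A with
  | Atom p => hA p
  | Not B => hN B (formula_nested_ind hA hN hC hD B)
  | And l => hC l (list_ind l)
  | Or l => hD l (list_ind l)
  end.

Lemma eval_ext v v' A : {in atoms A, v =1 v'} -> eval v A = eval v' A.
Proof.
elim/formula_nested_ind: A => [p|A IHA|l IHl|l IHl] /= vv'.
- by rewrite vv' ?mem_head.
- by rewrite IHA.
- apply: eq_in_all => A Al; apply: IHl => // p pA; apply: vv'.
  by apply/flattenP; exists (atoms A) => //; apply: map_f.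
- apply: eq_in_has => A Al; apply: IHl => // p pA; apply: vv'.
  by apply/flattenP; exists (atoms A) => //; apply: map_f.
Qed.

Lemma eval_subst v s A : eval v (subst s A) = eval (fun p => eval v (s p)) A.
Proof.
elim/formula_nested_ind: A => [p|A IHA|l IHl|l IHl] //=; first by rewrite IHA.
- by rewrite all_map; apply: eq_in_all.
- by rewrite has_map; apply: eq_in_has.
Qed.

Lemma eval_rename v xs F : eval v (rename xs F) = eval (fun p => v (nth 0 xs p)) F.
Proof. exact: eval_subst. Qed.

Lemma atoms_rename xs F : atoms (rename xs F) = [seq nth 0 xs p | p <- atoms F].
Proof.
rewrite /rename; elim/formula_nested_ind: F => [p|A IHA|l IHl|l IHl] //=;
by rewrite map_flatten -!map_comp; congr flatten; apply/eq_in_map.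
Qed.

(** Atoms are coded in unary, so a new name of value at most [B] lengthens a code by at most the
    factor [B.+1]. *)
Lemma size_enc_rename xs F B : (forall x, x \in xs -> x <= B) ->
  size (enc_form (rename xs F)) <= size (enc_form F) * B.+1.
Proof.
move=> xsB; have nthB p : nth 0 xs p <= B.
  have [pl|pl] := ltnP p (size xs); last by rewrite nth_default.
  by rewrite xsB ?mem_nth.
have listB l : (forall A, A \in l ->
    size (enc_form (rename xs A)) <= size (enc_form A) * B.+1) ->
  size (enc_list enc_form (map (rename xs) l)) <= size (enc_list enc_form l) * B.+1.
  rewrite !size_enc_list => lB; rewrite mulSn -map_comp.
  suff : sumn [seq (size (enc_form (rename xs A))).+1 | A <- l] <=
      sumn [seq (size (enc_form A)).+1 | A <- l] * B.+1 by rewrite /comp; lia.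
  elim: l lB => //= A l IHl lB; rewrite mulnDl leq_add //.
    by rewrite mulSn; have := lB A (mem_head _ _); lia.
  by apply: IHl => C Cl; apply: lB; rewrite inE Cl orbT.
elim/formula_nested_ind: F => [p|A IHA|l /listB IHl|l /listB IHl].
- by rewrite /= !size_enc_nat; have := nthB p; nia.
- by move: IHA; rewrite /rename /= !mulSn; lia.
- rewrite -[enc_form _]/[:: true, false & enc_list enc_form (map (rename xs) l)].
  by move: IHl; rewrite [size (_ :: _)]/= [size (enc_form _)]/= !mulSn; lia.
- rewrite -[enc_form _]/[:: true, true & enc_list enc_form (map (rename xs) l)].
  by move: IHl; rewrite [size (_ :: _)]/= [size (enc_form _)]/= !mulSn; lia.
Qed.

Lemma is_3clause_rename xs C : is_3clause C -> is_3clause (rename xs C).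
Proof.
case: C => // l /= /andP[sl /allP litl]; rewrite size_map sl all_map.
by apply/allP => A /litl /=; case: A => // -[].
Qed.

Lemma is_3CNF_rename xs F : is_3CNF F -> is_3CNF (rename xs F).
Proof.
by case: F => // l /= /allP cl; rewrite all_map; apply/allP => C /cl /= /is_3clause_rename->.
Qed.

Lemma assign_nth zs c i : uniq zs -> i < size zs ->
  assign zs c (nth 0 zs i) = nth false c i.
Proof. by move=> uzs izs; rewrite /assign index_uniq. Qed.

Lemma assign_cat xs ys a b p : p \in xs -> size a = size xs ->
  assign (xs ++ ys) (a ++ b) p = assign xs a p.
Proof.
by move=> pxs sa; rewrite /assign index_cat pxs nth_cat sa index_mem pxs.
Qed.

(** The falsifying assignment also falsifies the formula with [a] plugged in. Hence a query that the
    teacher answers correctly cannot end the game. *)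
Lemma plug_not_TAUT xs ys a b A : size a = size xs ->
  eval (assign (xs ++ ys) (a ++ b)) A = false -> ~ TAUT (plug xs a A).
Proof.
move=> sa evA /(_ (assign (xs ++ ys) (a ++ b))); rewrite eval_subst.
rewrite (@eval_ext _ (assign (xs ++ ys) (a ++ b))) ?evA // => p _.
by case: ifP => //= pxs; rewrite assign_cat //; case: (assign xs a p).
Qed.

Definition bit_of (i j : nat) : bool := odd (i %/ 2 ^ j).

Lemma bit_of_surj w (al : nat -> bool) :
  exists2 i, i < 2 ^ w & forall j, j < w -> bit_of i j = al j.
Proof.
elim: w => [|w [i iw iP]]; first by exists 0.
exists (al w * 2 ^ w + i); first by rewrite expnS; case: (al w); lia.
move=> j; rewrite ltnS leq_eqVlt => /predU1P[->|jw].
  by rewrite /bit_of divnMDl ?expn_gt0 // (divn_small iw) addn0; case: (al w).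
rewrite -(iP j jw) /bit_of -(subnK (ltnW jw)) expnD mulnA divnMDl ?expn_gt0 //.
by rewrite oddD oddM oddX subn_eq0 leqNgt jw /= andbF.
Qed.

Definition clauses (A : formula) : seq formula := if A is And l then l else [::].

(** The implication from [s] to a clause, written as a clause with one more literal, so that a
    guarded CNF is still a CNF. *)
Definition guard (s : nat) (C : formula) : formula :=
  if C is Or l then Or (Not (Atom s) :: l) else C.

Lemma eval_guard v s C : is_3clause C -> eval v (guard s C) = v s ==> eval v C.
Proof. by case: C => //= l _; rewrite implybE. Qed.

Lemma atoms_guard s C : {subset atoms (guard s C) <= s :: atoms C}.
Proof. by case: C => [p|A|l|l] p' p'C //; rewrite in_cons p'C orbT. Qed.

(** * Sequent calculus *)

Definition LK_step (H D : seq sequent) (T : sequent) : Prop :=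
  List.In T H \/ exists2 prems, LK_rule prems T & List.incl prems D.

(** [LK_derivation] without its condition on the last line, so that pieces can be concatenated. *)
Definition LK_lines (H D : seq sequent) : Prop :=
  forall D1 T D2, D = D1 ++ T :: D2 -> LK_step H D1 T.

Lemma LK_lines_nil H : LK_lines H [::].
Proof. by case. Qed.

Lemma LK_lines_rcons H D T : LK_lines H (rcons D T) <-> LK_lines H D /\ LK_step H D T.
Proof.
split=> [HD|[HD HT] D1 T1 D2].
  split=> [D1 T1 D2 E|]; last by apply: (HD D T [::]); rewrite cats1.
  by apply: (HD D1 T1 (rcons D2 T)); rewrite E rcons_cat.
case/lastP: D2 => [|D2 T2]; first by rewrite cats1 => /rcons_inj[<- <-].
by rewrite -rcons_cons -rcons_cat => /rcons_inj[E _]; apply: HD E.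
Qed.

Lemma LK_lines_cat H D D' : LK_lines H D -> LK_lines H D' -> LK_lines H (D ++ D').
Proof.
move=> HD; elim/last_ind: D' => [|D' T IHD']; first by rewrite cats0.
rewrite -rcons_cat !LK_lines_rcons => -[/IHD' HDD' [TH|[ps psT psD']]].
  by split=> //; left.
split=> //; right; exists ps => //.
exact: List.incl_appr.
Qed.

Section Derivable.

Variables (H : seq sequent) (ok : sequent -> Prop).

(** [m] counts lines. The size of the derivation is recovered at the end from the bound that [ok]
    puts on every line. *)
Definition derivable (m : nat) (S : sequent) : Prop :=
  exists D, [/\ LK_lines H D, List.In S D, size D <= m & forall T, List.In T D -> ok T].

Lemma derivable_leq m m' S : m <= m' -> derivable m S -> derivable m' S.
Proof. by move=> mm' [D [? ? sD ?]]; exists D; split=> //; apply: leq_trans mm'. Qed.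

Lemma derivable_list m ps : (forall p, List.In p ps -> derivable m p) ->
  exists D, [/\ LK_lines H D, List.incl ps D, size D <= size ps * m &
    forall T, List.In T D -> ok T].
Proof.
elim: ps => [|p ps IHps] psP.
  by exists [::]; split=> //; exact: LK_lines_nil.
have [D [HD psD sD okD]] := IHps (fun q qps => psP q (or_intror qps)).
have [D' [HD' pD' sD' okD']] := psP p (or_introl erefl).
exists (D' ++ D); split.
- exact: LK_lines_cat.
- move=> q [<-|/psD qD]; apply/List.in_app_iff; by [left | right].
- by rewrite size_cat mulSn leq_add.
by move=> T /List.in_app_iff[/okD'|/okD].
Qed.

(** The derivations of the premises are concatenated without sharing; the resulting products stay
    polynomial because the refutation has constant height. *)
Lemma derivable_rule m ps S : (forall p, List.In p ps -> derivable m p) ->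
  LK_rule ps S -> ok S -> derivable (size ps * m).+1 S.
Proof.
case/derivable_list=> D [HD psD sD okD] psS okS; exists (rcons D S); split.
- by apply/LK_lines_rcons; split=> //; right; exists ps.
- by rewrite -cats1; apply/List.in_app_iff; right; left.
- by rewrite size_rcons.
by move=> T; rewrite -cats1 => /List.in_app_iff[/okD|[<-|[]]].
Qed.

Lemma derivable_rule0 S : LK_rule [::] S -> ok S -> derivable 1 S.
Proof. by move=> rS okS; apply: (derivable_rule (m := 0) (ps := [::])). Qed.

Lemma derivable_rule1 m p S : derivable m p -> LK_rule [:: p] S -> ok S -> derivable m.+1 S.
Proof.
move=> pm rS okS; rewrite -[m]mul1n; apply: (derivable_rule (ps := [:: p])) => //.
by move=> q [<-|[]].
Qed.

Lemma derivable_rule2 m p q S : derivable m p -> derivable m q -> LK_rule [:: p; q] S ->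
  ok S -> derivable (2 * m).+1 S.
Proof.
move=> pm qm rS okS; apply: (derivable_rule (ps := [:: p; q])) => //.
by move=> ? [<-|[<-|[]]].
Qed.

Lemma derivable_hyp S : List.In S H -> ok S -> derivable 1 S.
Proof.
move=> SH okS; exists [:: S]; split=> //=; try by [left | case=> [<-|[]]].
  by apply/(LK_lines_rcons _ [::]); split; [exact: LK_lines_nil | left].
by move=> T [<-|[]].
Qed.

End Derivable.

(* A subclass of the depth-1 formulas that, unlike [Sigma_depth_le t 1], does not
   mention the size of the whole derivation, and is closed under subformulas. *)
Definition flat (w : nat) (A : formula) : bool :=
  small w A || (if A is And l then all (small w) l else false).

Lemma small_leq t t' A : t <= t' -> small t A -> small t' A.
Proof. by move=> tt'; case: A => //= l /andP[/leq_trans->]. Qed.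

Lemma flat_depth w t A : w <= t -> flat w A -> Sigma_depth_le t 1 A.
Proof.
move=> wt /orP[/(small_leq wt) sA|].
  by left; apply: Sigma_upS; apply: Sigma_small.
case: A => // l /allP sl; right; apply: Pi_and => A /InP /sl /(small_leq wt) sA.
exact: Sigma_small.
Qed.

Lemma small_lit w A : is_lit A -> small w A.
Proof. by case: A. Qed.

Section Bounded.

Variables (w B K : nat) (H : seq sequent).

Definition bounded_formula (A : formula) : bool := (size (enc_form A) <= B) && flat w A.

Definition bounded (T : sequent) : Prop :=
  size (T.1 ++ T.2) <= K /\ all bounded_formula (T.1 ++ T.2).

Notation derives := (derivable H bounded).

Lemma size_enc_mem A l : A \in l -> size (enc_form A) <= size (enc_list enc_form l).
Proof.
rewrite size_enc_list => Al; apply: leq_trans (leqnSn _).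
by elim: l Al => //= C l IHl; rewrite inE => /predU1P[->|/IHl]; lia.
Qed.

Lemma bounded_or A l : A \in l -> bounded_formula (Or l) -> is_lit A /\ bounded_formula A.
Proof.
move=> Al /andP[sl /=]; rewrite /flat orbF => /andP[_ /allP/(_ A Al) litA].
split=> //; rewrite /bounded_formula /flat small_lit // andbT.
by apply: leq_trans (leq_trans (size_enc_mem Al) _) sl; rewrite /= -addn2 leq_addr.
Qed.

Lemma bounded_and A l : A \in l -> bounded_formula (And l) -> bounded_formula A.
Proof.
move=> Al /andP[sl fl]; apply/andP; split.
  by apply: leq_trans (leq_trans (size_enc_mem Al) _) sl; rewrite /= -addn2 leq_addr.
case/orP: fl => [/andP[_]|] /allP/(_ A Al) sA; rewrite /flat ?sA //.
by rewrite small_lit.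
Qed.

Lemma bounded_atom p : bounded_formula (Not (Atom p)) -> bounded_formula (Atom p).
Proof. by rewrite /bounded_formula /= !andbT; lia. Qed.

Hypothesis K_ge : 4 <= K.

(** Initial sequents exist for atoms only; a negated atom costs both negation rules and an
    exchange. *)
Lemma derives_lit A : is_lit A -> bounded_formula A -> derives 4 ([:: A], [:: A]).
Proof.
have ax p : bounded_formula (Atom p) -> derives 1 ([:: Atom p], [:: Atom p]).
  move=> bp; apply: derivable_rule0; first exact: LK_ax.
  by split; rewrite /= ?bp //; lia.
case: A => // [p _ /ax|[] // p _ bNp]; first exact: derivable_leq.
have bp := bounded_atom bNp.
apply: (derivable_rule1 (p := ([:: Atom p; Not (Atom p)], [::]))); first last.
- by split; rewrite /= ?bNp //; lia.
- exact: (LK_notR [:: _] [::]).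
apply: (derivable_rule1 (p := ([:: Not (Atom p); Atom p], [::]))); first last.
- by split; rewrite /= ?bNp ?bp //; lia.
- by apply: LK_struct => // q; case=> [<-|[<-|[]]]; [right; left | left].
apply: derivable_rule1 (ax p bp) _ _.
- exact: (LK_notL [:: _] [::]).
- by split; rewrite /= ?bNp ?bp //; lia.
Qed.

Lemma derives_guard s C : is_3clause C -> bounded_formula C -> bounded_formula (guard s C) ->
  derives 25 ([:: guard s C; Atom s], [:: C]).
Proof.
case: C => // l /= /andP[sl _] bC bG.
have [_ bNs] := bounded_or (mem_head _ _) bG; have bs := bounded_atom bNs.
pose ps := [seq (A :: [:: Atom s], [:: Or l]) | A <- Not (Atom s) :: l].
(* A guarded clause has at most four literals and each branch takes at most six lines, whence 25. *)
apply: (@derivable_leq _ _ (size ps * 6).+1); first by rewrite size_map /=; lia.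
apply: derivable_rule; [|exact: LK_orL|by split; rewrite /= ?bG ?bC ?bs //; lia].
move=> _ /In_map_seq[A /InP + ->]; rewrite inE => /predU1P[->|Al].
  apply: (@derivable_leq _ _ (5).+1) => //.
  apply: (derivable_rule1 (p := ([:: Atom s], [:: Atom s; Or l]))); first last.
  - by split; rewrite /= ?bNs ?bC ?bs //; lia.
  - exact: LK_notL.
  apply: derivable_rule1 (derives_lit (A := Atom s) _ bs) _ _ => //.
    by apply: LK_struct => q; case=> [<-|[]]; left.
  by split; rewrite /= ?bNs ?bC ?bs //; lia.
have [litA bA] := bounded_or Al bC.
apply: (derivable_rule1 (p := ([:: A; Atom s], [:: A]))); first last.
- by split; rewrite /= ?bA ?bC ?bs //; lia.
- by apply: LK_orR; apply/InP.
apply: derivable_rule1 (derives_lit litA bA) _ _ => //.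
  by apply: LK_struct => q; case=> [<-|[]]; left.
by split; rewrite /= ?bA ?bC ?bs //; lia.
Qed.

End Bounded.

(** * The formulas N_i and their refutation *)

Section ClauseFamily.

Variables (w n lu lv : nat) (fU fV : formula).

Definition wit_len (i j : nat) : nat := if bit_of i j then lv else lu.
Definition wit_form (i j : nat) : formula := if bit_of i j then fV else fU.

Definition xvars : seq nat := iota 0 (w * n).
Definition xblock (j : nat) : seq nat := iota (j * n) n.

(* The auxiliary atoms of index [i]: [w] selectors, then [w] blocks, each with room
   for a witness of either set. *)
Definition ysize : nat := w + w * (lu + lv).
Definition ybase (i : nat) : nat := w * n + i * ysize.
Definition yvars (i : nat) : seq nat := iota (ybase i) ysize.
Definition sel (i j : nat) : nat := ybase i + j.
Definition wblock (i j : nat) : seq nat :=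
  iota (ybase i + w + j * (lu + lv)) (wit_len i j).

(** It acts as a literal, asserting that the value of the [j]-th string differs from bit [j] of [i],
    where membership in U is the value 1. *)
Definition lit (i j : nat) : formula :=
  rename (xblock j ++ wblock i j) (wit_form i j).

Definition selector (i : nat) : formula := Or [seq Atom (sel i j) | j <- iota 0 w].

Definition guarded (i : nat) : seq formula :=
  flatten [seq [seq guard (sel i j) C | C <- clauses (lit i j)] | j <- iota 0 w].

(* Says of some [j < w], pointed at by its selector, that the [j]-th string lies in
   V if the [j]-th bit of [i] is 1 and in U if it is 0. *)
Definition clause (i : nat) : formula := And (selector i :: guarded i).

Definition natoms : nat := w * n + 2 ^ w * ysize.

Lemma wit_len_le i j : wit_len i j <= lu + lv.
Proof. by rewrite /wit_len; case: ifP; rewrite ?leq_addl ?leq_addr. Qed.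

Lemma mem_wblock i j p : j < w -> p \in wblock i j -> p \in yvars i.
Proof. by rewrite !mem_iota /ysize; have := wit_len_le i j; nia. Qed.

Lemma mem_xblock j p : j < w -> p \in xblock j -> p \in xvars.
Proof. by rewrite !mem_iota; nia. Qed.

Lemma vars_uniq r : uniq (xvars ++ flatten [seq yvars i | i <- iota 0 r]).
Proof.
suff -> : xvars ++ flatten [seq yvars i | i <- iota 0 r] = iota 0 (w * n + r * ysize).
  exact: iota_uniq.
elim: r => [|r IHr]; first by rewrite mul0n addn0 cats0.
rewrite -[r.+1]addn1 iotaD map_cat flatten_cat catA IHr /= cats0 add0n.
by rewrite mulnDl mul1n addnA [RHS]iotaD.
Qed.

Lemma nth_vars i p : nth 0 (xvars ++ yvars i) p =
  if p < w * n then p else nth 0 (yvars i) (p - w * n).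
Proof. by rewrite nth_cat size_iota; case: ltnP => // pw; rewrite nth_iota. Qed.

Lemma uniq_vars i : uniq (xvars ++ yvars i).
Proof.
rewrite cat_uniq !iota_uniq andbT /=; apply/hasPn => p; rewrite !mem_iota /ybase.
by case/andP=> /(leq_trans (leq_addr _ _)) wp _; rewrite -leqNgt.
Qed.

Lemma assign_x i a b p : p < w * n -> size a = w * n ->
  assign (xvars ++ yvars i) (a ++ b) p = nth false a p.
Proof.
move=> pw sa; have pE : nth 0 (xvars ++ yvars i) p = p by rewrite nth_vars pw.
rewrite -{1}pE assign_nth ?uniq_vars ?size_cat ?size_iota ?ltn_addr //.
by rewrite nth_cat sa pw.
Qed.

Lemma assign_y i a b q : q < ysize -> size a = w * n ->
  assign (xvars ++ yvars i) (a ++ b) (ybase i + q) = nth false b q.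
Proof.
move=> qy sa; have -> : ybase i + q = nth 0 (xvars ++ yvars i) (w * n + q).
  by rewrite nth_vars ltnNge leq_addr /= addKn nth_iota.
rewrite assign_nth ?uniq_vars ?size_cat ?size_iota ?ltn_add2l //.
by rewrite nth_cat sa ltnNge leq_addr /= addKn.
Qed.

Lemma yvars_inj i i' p : p \in yvars i -> p \in yvars i' -> i = i'.
Proof.
have sep a b : a < b -> p \in yvars a -> p \notin yvars b.
  move=> ab; rewrite !mem_iota /ybase => /andP[_ pa]; rewrite negb_and -ltnNge.
  by have := leq_mul2r ysize a.+1 b; rewrite ab orbT mulSn => /idP; lia.
move=> pi pi'; case: (ltngtP i i') => // [/sep/(_ pi)|/sep/(_ pi')]; by rewrite ?pi ?pi'.
Qed.

(** Different indices own different witness atoms even for the same string, as the short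
    disjointness proofs require. *)
Lemma blocks_uniq i i' j : i != i' -> j < w ->
  uniq (xblock j ++ wblock i j ++ wblock i' j).
Proof.
move=> ii' jw; rewrite !cat_uniq !iota_uniq /= andbT; apply/andP; split.
  apply/hasPn => p; rewrite mem_cat => pw; apply/negP => /(mem_xblock jw).
  rewrite mem_iota => /andP[_]; case/orP: pw => /(mem_wblock jw);
    by rewrite mem_iota /ybase => /andP[+ _]; lia.
apply/hasPn => p /(mem_wblock jw) pi'; apply/negP => /(mem_wblock jw) pi.
by move: ii'; rewrite (yvars_inj pi pi') eqxx.
Qed.

(** Selector [j0] alone is on and [wit] is written into block [j0]. Because subtraction truncates,
    other blocks may receive stray bits; their selectors are off, which makes their guarded clauses
    true. *)
Definition teacher_bits (j0 : nat) (wit : bits) : bits :=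
  mkseq (fun p => if p < w then p == j0 else nth false wit (p - w - j0 * (lu + lv))) ysize.

Lemma yvars_natoms i p : i < 2 ^ w -> p \in yvars i -> p < natoms.
Proof.
rewrite mem_iota /ybase /natoms => iw /andP[_].
by have := leq_mul2r ysize i.+1 (2 ^ w); rewrite iw orbT mulSn => /idP; lia.
Qed.

Lemma sel_natoms i j : i < 2 ^ w -> j < w -> sel i j < natoms.
Proof.
by move=> iw jw; apply: (yvars_natoms iw); rewrite mem_iota /sel /ysize; lia.
Qed.

Hypotheses (cnfU : is_3CNF fU) (cnfV : is_3CNF fV).
Hypotheses (atomsU : {subset atoms fU <= iota 0 (n + lu)})
           (atomsV : {subset atoms fV <= iota 0 (n + lv)}).

Lemma is_3CNF_lit i j : is_3CNF (lit i j).
Proof. by apply: is_3CNF_rename; rewrite /wit_form; case: ifP. Qed.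

Lemma lit_clauses i j : lit i j = And (clauses (lit i j)).
Proof. by have := is_3CNF_lit i j; case: (lit i j). Qed.

Lemma is_3clause_lit i j C : C \in clauses (lit i j) -> is_3clause C.
Proof. by have := is_3CNF_lit i j; case: (lit i j) => //= l /allP cl /cl. Qed.

Lemma guardedP i C : reflect
  (exists j D, [/\ j < w, D \in clauses (lit i j) & C = guard (sel i j) D])
  (C \in guarded i).
Proof.
apply: (iffP flattenP) => [[_ /mapP[j jw ->] /mapP[D Dj ->]]|[j [D [jw Dj ->]]]].
  by exists j, D; rewrite mem_iota in jw.
exists [seq guard (sel i j) D | D <- clauses (lit i j)]; last exact: map_f.
by apply/mapP; exists j; rewrite ?mem_iota.
Qed.

Lemma atoms_lit i j : {subset atoms (lit i j) <= xblock j ++ wblock i j}.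
Proof.
move=> p; rewrite atoms_rename => /mapP[q qF ->]; apply: mem_nth.
rewrite size_cat !size_iota; move: qF; rewrite /wit_form /wit_len.
by case: ifP => _ => [/atomsV|/atomsU]; rewrite mem_iota.
Qed.

Lemma atoms_clause i : {subset atoms (clause i) <= xvars ++ yvars i}.
Proof.
have selP j : j < w -> sel i j \in xvars ++ yvars i.
  by move=> jw; rewrite mem_cat !mem_iota /sel /ysize; apply/orP; right; nia.
move=> p /= ; rewrite mem_cat => /orP[/flattenP[_ /mapP[_ /mapP[j jw ->] ->]]|].
  by rewrite /= inE => /eqP->; apply: selP; rewrite mem_iota in jw.
case/flattenP=> _ /mapP[_ /guardedP[j [D [jw Dj ->]]] ->] /atoms_guard.
rewrite inE => /predU1P[->|pD]; first exact: selP.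
have : p \in atoms (lit i j).
  by rewrite lit_clauses; apply/flattenP; exists (atoms D) => //; apply: map_f.
move/atoms_lit; rewrite !mem_cat => /orP[/(mem_xblock jw)->//|/(mem_wblock jw)->].
by rewrite orbT.
Qed.

Lemma eval_clause i j0 a aj wit : j0 < w -> size a = w * n -> size aj = n ->
  (forall p, p < n -> nth false a (j0 * n + p) = nth false aj p) ->
  eval (nth false (aj ++ wit)) (wit_form i j0) ->
  eval (assign (xvars ++ yvars i) (a ++ teacher_bits j0 wit)) (clause i).
Proof.
move=> j0w sa saj aP evF; set v := assign _ _.
have v_sel j : j < w -> v (sel i j) = (j == j0).
  move=> jw; rewrite /v /sel assign_y ?nth_mkseq ?jw // /ysize; lia.
have v_lit : eval v (lit i j0).
  rewrite eval_rename -(@eval_ext (nth false (aj ++ wit))) // => p pF.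
  have {pF}pn : p < n + wit_len i j0.
    move: pF; rewrite /wit_form /wit_len.
    by case: ifP => _ => [/atomsV|/atomsU]; rewrite mem_iota.
  rewrite !nth_cat saj size_iota; case: ltnP => np.
    have lt : j0 * n + p < w * n.
      by have := leq_mul2r n j0.+1 w; rewrite j0w orbT mulSn => /idP; lia.
    by rewrite nth_iota // /v assign_x // aP.
  have wl := wit_len_le i j0.
  have yw : w + j0 * (lu + lv) + (p - n) < ysize.
    have := leq_mul2r (lu + lv) j0.+1 w; rewrite j0w orbT mulSn => /idP.
    by rewrite /ysize; lia.
  have pl : p - n < wit_len i j0 by lia.
  have -> : nth 0 (wblock i j0) (p - n) =
      ybase i + (w + j0 * (lu + lv) + (p - n)) by rewrite nth_iota // !addnA.
  rewrite /v assign_y // nth_mkseq // -addnA ltnNge leq_addr /= addKn.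
  by rewrite addKn.
rewrite /= ; apply/andP; split.
  rewrite has_map; apply/hasP; exists j0; first by rewrite mem_iota.
  by rewrite /= v_sel.
apply/allP => _ /guardedP[j [D [jw Dj ->]]].
rewrite eval_guard ?(is_3clause_lit Dj) // v_sel //; apply/implyP => /eqP jj0.
by move: v_lit; rewrite -jj0 lit_clauses => /allP/(_ D Dj).
Qed.

Lemma size_enc_or l :
  size (enc_form (Or l)) = (sumn [seq (size (enc_form A)).+1 | A <- l]).+3.
Proof. by rewrite -size_enc_list. Qed.

Lemma size_enc_and l :
  size (enc_form (And l)) = (sumn [seq (size (enc_form A)).+1 | A <- l]).+3.
Proof. by rewrite -size_enc_list. Qed.

(** One bound for all formulas of the refutation: [s] covers each [lit], the term [w * (natoms + 4)]
    the selector, and the product with [natoms + 7] the guarded clauses. *)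
Definition form_bound : nat :=
  let s := (size (enc_form fU) + size (enc_form fV)) * natoms.+1 in
  7 + w * (natoms + 4) + w * (s * (natoms + 7)) + s.

Lemma size_enc_lit i j : i < 2 ^ w -> j < w -> size (enc_form (lit i j)) <=
  (size (enc_form fU) + size (enc_form fV)) * natoms.+1.
Proof.
move=> iw jw; apply: leq_trans (size_enc_rename _ (B := natoms) _) _.
  move=> p; rewrite mem_cat => /orP[/(mem_xblock jw)|/(mem_wblock jw)/(yvars_natoms iw)/ltnW//].
  by rewrite mem_iota /natoms; lia.
by rewrite leq_mul2r /wit_form; case: ifP => _; rewrite ?leq_addl ?leq_addr orbT.
Qed.

Lemma size_enc_guard s C : size (enc_form (guard s C)) <= size (enc_form C) + s + 6.
Proof.
case: C => [p|A|l|l]; rewrite /guard; try lia.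
by rewrite !size_enc_or /= size_enc_nat; lia.
Qed.

Lemma size_enc_lit_bound i j : i < 2 ^ w -> j < w -> size (enc_form (lit i j)) <= form_bound.
Proof. by move=> iw jw; have := size_enc_lit iw jw; rewrite /form_bound /=; lia. Qed.

Lemma size_enc_clause i : i < 2 ^ w -> size (enc_form (clause i)) <= form_bound.
Proof.
move=> iw; rewrite size_enc_and.
have sel_le : size (enc_form (selector i)) <= 3 + w * (natoms + 4).
  rewrite size_enc_or !ltnS -map_comp -[X in _ <= X * _](size_iota 0).
  apply: sumn_map_le => j; rewrite mem_iota => /(sel_natoms iw) /=.
  by rewrite size_enc_nat; lia.
suff guarded_le : sumn [seq (size (enc_form A)).+1 | A <- guarded i] <=
    w * ((size (enc_form fU) + size (enc_form fV)) * natoms.+1 * (natoms + 7)).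
  have -> : sumn [seq (size (enc_form A)).+1 | A <- selector i :: guarded i] =
    (size (enc_form (selector i))).+1 + sumn [seq (size (enc_form A)).+1 | A <- guarded i].
    by [].
  rewrite /form_bound; move: sel_le guarded_le; set a := size (enc_form (selector i)).
  by set b := sumn _; set c := w * (natoms + 4); set d := w * _; set s := _ * natoms.+1; lia.
rewrite /guarded map_flatten sumn_flatten -!map_comp -[X in _ <= X * _](size_iota 0).
apply: sumn_map_le => j; rewrite mem_iota => /= jw.
have := size_enc_lit iw jw; rewrite {1}lit_clauses size_enc_and -map_comp => le.
apply: leq_trans (_ : sumn [seq (size (enc_form C)).+1 | C <- clauses (lit i j)]
  * (natoms + 7) <= _); last by rewrite leq_mul2r; apply/orP; right; lia.
elim: (clauses _) {le} => //= C l IHl; rewrite mulnDl leq_add //.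
by have := size_enc_guard (sel i j) C; have := sel_natoms iw jw; nia.
Qed.

(** A line holds the [2 ^ w] premises, at most [2 ^ w] chosen selectors, and up to four formulas in
    transit. *)
Definition line_bound : nat := 2 * 2 ^ w + 4.

Hypothesis w_ge4 : 4 <= w.

Lemma small_3clause C : is_3clause C -> small w C.
Proof. by case: C => //= l /andP[/leq_trans->] //; apply: leq_trans w_ge4. Qed.

Lemma small_guard s C : is_3clause C -> small w (guard s C).
Proof. by case: C => //= l /andP[sl ->]; rewrite andbT; apply: leq_trans w_ge4. Qed.

Lemma bounded_lit i j : i < 2 ^ w -> j < w -> bounded_formula w form_bound (lit i j).
Proof.
move=> iw jw; rewrite /bounded_formula size_enc_lit_bound //=.
rewrite lit_clauses /flat; apply/orP; right; apply/allP => C Cl.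
exact/small_3clause/(is_3clause_lit Cl).
Qed.

Lemma bounded_clause i : i < 2 ^ w -> bounded_formula w form_bound (clause i).
Proof.
move=> iw; rewrite /bounded_formula size_enc_clause //.
apply/orP; right; rewrite /=; apply/andP; split.
  by rewrite size_map size_iota leqnn; apply/allP => _ /mapP[j _ ->].
by apply/allP => _ /guardedP[j [D [_ Dj ->]]]; apply/small_guard/(is_3clause_lit Dj).
Qed.

Lemma bounded_selector i : i < 2 ^ w -> bounded_formula w form_bound (selector i).
Proof. by move/bounded_clause; apply: bounded_and (mem_head _ _). Qed.

Lemma bounded_sel i j : i < 2 ^ w -> j < w ->
  bounded_formula w form_bound (Atom (sel i j)).
Proof.
move=> iw jw; move: (bounded_selector iw).
have sj : Atom (sel i j) \in [seq Atom (sel i j) | j <- iota 0 w].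
  by apply: map_f; rewrite mem_iota.
by case/(bounded_or sj).
Qed.

Variable H : seq sequent.

(** Where [i] has bit 1 and [i'] has bit 0, the two literals put the same string into V and into U.
    These sequents are all that the refutation uses of disjointness. *)
Hypothesis conflict_hyp : forall i i' j, i < 2 ^ w -> i' < 2 ^ w -> j < w ->
  bit_of i j -> ~~ bit_of i' j -> List.In ([:: lit i' j; lit i j], [::]) H.

Notation derives := (derivable H (bounded w form_bound line_bound)).

Lemma line_bound_ge4 : 4 <= line_bound. Proof. by rewrite /line_bound leq_addl. Qed.

Lemma derives_selected i j : i < 2 ^ w -> j < w ->
  derives (form_bound * 26).+1 ([:: clause i; Atom (sel i j)], [:: lit i j]).
Proof.
move=> iw jw; have bc := bounded_clause iw; have bs := bounded_sel iw jw.
have bl := bounded_lit iw jw; have l4 := line_bound_ge4.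
pose ps := [seq ([:: clause i; Atom (sel i j)], [:: C]) | C <- clauses (lit i j)].
have sps : size ps <= form_bound.
  have := size_enc_lit_bound iw jw; rewrite {1}lit_clauses size_enc_and size_map.
  have : size (clauses (lit i j)) <=
      sumn [seq (size (enc_form A)).+1 | A <- clauses (lit i j)].
    by elim: (clauses _) => //= C l; lia.
  by lia.
apply: (@derivable_leq _ _ (size ps * 26).+1); first by rewrite ltnS leq_mul2r sps.
apply: derivable_rule; last 2 first.
- by rewrite [in X in LK_rule _ X]lit_clauses; apply: LK_andR.
- by split; rewrite /= ?bc ?bs ?bl //; lia.
move=> _ /In_map_seq[C /InP Cl ->].
have gC : guard (sel i j) C \in selector i :: guarded i.
  by rewrite inE; apply/orP; right; apply/guardedP; exists j, C.
have bC : bounded_formula w form_bound C by move: bl; rewrite lit_clauses; apply: bounded_and.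
have bG := bounded_and gC bc.
apply: derivable_rule1 (derives_guard _ l4 (is_3clause_lit Cl) bC bG) _ _.
  by apply: LK_andL; apply/InP.
by split; rewrite /= ?bc ?bs ?bC //; lia.
Qed.

Definition conflict_cost : nat := 4 * (form_bound * 26).+1 + 7.

(** The chosen selectors yield both [lit i j] and [lit i' j]; two cuts against the conflict
    hypothesis finish. *)
Lemma derives_conflict i i' j G : i < 2 ^ w -> i' < 2 ^ w -> j < w ->
  bit_of i j -> ~~ bit_of i' j -> size G <= 2 * 2 ^ w ->
  all (bounded_formula w form_bound) G ->
  clause i \in G -> clause i' \in G -> Atom (sel i j) \in G -> Atom (sel i' j) \in G ->
  derives conflict_cost (G, [::]).
Proof.
move=> iw i'w jw bij bi'j sG bG ciG ci'G siG si'G.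
set c := (form_bound * 26).+1.
have ok G' D : size (G' ++ D) <= 4 -> all (bounded_formula w form_bound) (G' ++ D) ->
  bounded w form_bound line_bound (G' ++ G, D).
  move=> s4; rewrite all_cat => /andP[bG' bD]; split; rewrite /= ?all_cat ?bG ?bG' ?bD //.
  by move: s4; rewrite !size_cat /line_bound; lia.
have bl := bounded_lit iw jw; have bl' := bounded_lit i'w jw.
have get G' i0 : {subset G <= G'} -> i0 < 2 ^ w -> clause i0 \in G -> Atom (sel i0 j) \in G ->
    bounded w form_bound line_bound (G', [:: lit i0 j]) ->
    derives c.+1 (G', [:: lit i0 j]).
  move=> GG' i0w cG sG0 okG'; apply: derivable_rule1 (derives_selected i0w jw) _ okG'.
  by apply: LK_struct => // A; case=> [<-|[<-|[]]]; apply/InP/GG'.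
apply: (@derivable_leq _ _ (2 * (2 * c.+1).+1).+1); first by rewrite /conflict_cost; lia.
apply: (derivable_rule2 (p := (G, [:: lit i j])) (q := (lit i j :: G, [::]))).
- by apply: (derivable_leq (m := c.+1)); [lia | apply: get => //; apply: (ok [::]); rewrite /= ?bl].
- apply: (derivable_rule2 (p := (lit i j :: G, [:: lit i' j]))
    (q := (lit i' j :: lit i j :: G, [::]))).
  + apply: get => //; last by apply: (ok [:: _]); rewrite /= ?bl ?bl'.
    by move=> A AG; rewrite inE AG orbT.
  + apply: (derivable_leq (m := 2)); first by rewrite /c; lia.
    have okH : bounded w form_bound line_bound ([:: lit i' j; lit i j], [::]).
      by split; rewrite /= ?bl ?bl' // /line_bound; lia.
    apply: derivable_rule1 (derivable_hyp (conflict_hyp iw i'w jw bij bi'j) okH) _ _.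
      by apply: LK_struct => // A; case=> [<-|[<-|[]]]; [left | right; left].
    by apply: (ok [:: _; _]); rewrite /= ?bl ?bl'.
  + exact: LK_cut.
  + by apply: (ok [:: _]); rewrite /= ?bl.
- exact: LK_cut.
by apply: (ok [::]).
Qed.

(* Consistent choices would agree with an assignment, whose own index could not
   have been given a choice. *)
Lemma conflict_exists (P : seq (nat * nat)) :
  (forall i, i < 2 ^ w -> exists2 j, j < w & (i, j) \in P) ->
  exists i i' j, [/\ (i, j) \in P, (i', j) \in P, bit_of i j & ~~ bit_of i' j].
Proof.
move=> cover; pose al j := ~~ has (fun p => (p.2 == j) && bit_of p.1 j) P.
have [i' i'w i'P] := bit_of_surj w al; have [j jw i'jP] := cover i' i'w.
case bi'j: (bit_of i' j).
  have := i'P j jw; rewrite bi'j /al => /esym/hasPn/(_ _ i'jP) /=.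
  by rewrite eqxx bi'j.
have := i'P j jw; rewrite bi'j /al => /esym/negbFE/hasP[[i j'] ijP /andP[/eqP/= j'j bij]].
by exists i, i', j; rewrite -{1}j'j ijP i'jP bij bi'j.
Qed.

Definition premises : seq formula := [seq clause i | i <- iota 0 (2 ^ w)].

(** A search tree: [P] records a selector for every clause of index at least [r], and the step
    branches on the [w] selectors of the next lower clause. At a leaf every clause has a choice and
    [conflict_exists] supplies a contradiction. *)
Lemma derives_choices r (P : seq (nat * nat)) : r <= 2 ^ w -> size P + r <= 2 ^ w ->
  (forall p, p \in P -> p.1 < 2 ^ w /\ p.2 < w) ->
  (forall i, r <= i -> i < 2 ^ w -> exists2 j, j < w & (i, j) \in P) ->
  derives ((w + 4) ^ r * conflict_cost.+1) ([seq Atom (sel p.1 p.2) | p <- P] ++ premises, [::]).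
Proof.
have mem_prem i : i < 2 ^ w -> clause i \in premises.
  by move=> iw; apply: map_f; rewrite mem_iota.
have ok l P' : size l <= 1 -> all (bounded_formula w form_bound) l -> size P' <= 2 ^ w ->
    (forall p, p \in P' -> p.1 < 2 ^ w /\ p.2 < w) ->
    bounded w form_bound line_bound (l ++ [seq Atom (sel p.1 p.2) | p <- P'] ++ premises, [::]).
  move=> sl bl sP' P'P; split.
    rewrite cats0 !size_cat size_map [size premises]size_map size_iota /line_bound.
    by apply: leq_trans (leq_add sl (leq_add sP' (leqnn _))) _; lia.
  rewrite /= cats0 !all_cat bl andTb; apply/andP; split.
    by apply/allP => _ /mapP[p /P'P[p1 p2] ->]; apply: bounded_sel.
  by apply/allP => _ /mapP[i + ->]; rewrite mem_iota => iw; apply: bounded_clause.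
elim: r P => [|r IHr] P rw sP PP cover;
  have sP0 : size P <= 2 ^ w := leq_trans (leq_addr _ _) sP.
  rewrite expn0 mul1n; apply: (derivable_leq (leqnSn _)).
  have [|i [i' [j [ijP i'jP bij bi'j]]]] := @conflict_exists P.
    by move=> i; apply: cover.
  have [/= iw jw] := PP _ ijP; have [/= i'w _] := PP _ i'jP.
  have [] := ok [::] P isT isT sP0 PP.
  rewrite /= !cats0 => _ bG.
  apply: (derives_conflict (i := i) (i' := i') (j := j)) => //.
  - by rewrite size_cat !size_map size_iota mul2n -addnn leq_add2r.
  - by rewrite mem_cat mem_prem ?orbT.
  - by rewrite mem_cat mem_prem ?orbT.
  - by rewrite mem_cat (map_f (fun p => Atom (sel p.1 p.2)) ijP).
  - by rewrite mem_cat (map_f (fun p => Atom (sel p.1 p.2)) i'jP).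
set M := (w + 4) ^ r * conflict_cost.+1 in IHr.
(* Beyond the [w] branches there are three lines, by the rules for disjunction, conjunction and
   contraction; the base [w + 4] covers them since [0 < M]. *)
apply: (@derivable_leq _ _ (w * M).+3).
  rewrite expnS -mulnA -/M; have : 0 < M by rewrite muln_gt0 expn_gt0 addnS.
  by nia.
set G := _ ++ premises.
apply: (derivable_rule1 (p := (clause r :: G, [::]))); last exact: (ok [::]).
  apply: (derivable_rule1 (p := (selector r :: G, [::]))).
  - have -> : w * M = size [seq (A :: G, [::] : seq formula) | A <-
        [seq Atom (sel r j) | j <- iota 0 w]] * M by rewrite !size_map size_iota.
    apply: derivable_rule; last 2 first.
    + exact: LK_orL.
    + by apply: (ok [:: _]) => //=; rewrite bounded_selector.
    move=> _ /In_map_seq[_ /In_map_seq[j /InP jw ->] ->].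
    apply: (IHr ((r, j) :: P)) => /=.
    + exact: ltnW.
    + by rewrite addSnnS.
    + move=> p; rewrite inE => /predU1P[->|/PP//].
      by rewrite mem_iota in jw.
    + move=> i; rewrite leq_eqVlt => /predU1P[<- _|ri /(cover i ri)[j' j'w ijP]].
        by exists j; [rewrite mem_iota in jw | rewrite mem_head].
      by exists j' => //; rewrite inE ijP orbT.
  - by apply: LK_andL; left.
  by apply: (ok [:: _]) => //=; rewrite bounded_clause.
by apply: LK_struct => // A; case=> [<-|//]; apply/InP; rewrite mem_cat mem_prem ?orbT.
Qed.

Definition derivation_bound : nat :=
  (((w + 4) ^ (2 ^ w) * conflict_cost.+1).+1 * (line_bound * form_bound.+1).+3).+1.

Lemma size_enc_sequent_le T : bounded w form_bound line_bound T ->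
  size (enc_sequent T) <= (line_bound * form_bound.+1).+2.
Proof.
case: T => G D [/= sGD]; rewrite all_cat => /andP[/allP bG /allP bD].
rewrite /enc_sequent size_cat /=; rewrite /= size_cat in sGD.
have sG := size_enc_list_le (e := enc_form) (l := G) (B := form_bound)
  (fun A AG => proj1 (andP (bG A AG))).
have sD := size_enc_list_le (e := enc_form) (l := D) (B := form_bound)
  (fun A AD => proj1 (andP (bD A AD))).
apply: leq_trans (leq_add sG sD) _.
by rewrite addSn addnS !ltnS -mulnDl leq_mul2r sGD orbT.
Qed.

Lemma clause_derivation : exists2 D, LK_half_derivation 1 H D (premises, [::]) &
  size (enc_derivation D) <= derivation_bound.
Proof.
have [|p|i ri iw|D [HD SD sD okD]] := derives_choices (P := [::]) (leqnn (2 ^ w)) _ _ _.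
- by rewrite add0n.
- by [].
- by move: (leq_trans iw ri); rewrite ltnn.
set S := (premises, [::]) : sequent; rewrite -[in List.In _ D]/S in SD.
pose D' := rcons D S.
have okD' T : List.In T D' -> bounded w form_bound line_bound T.
  by rewrite /D' -cats1 => /List.in_app_iff[/okD //|[<-|[]]]; apply: okD.
(* The width allowed is the logarithm of the size of the derivation. Its last line lists [2 ^ w]
   premises, so this logarithm is at least [w] and [flat w] formulas qualify. *)
have wD' : w <= trunc_log 2 (size (enc_derivation D')).
  apply: trunc_log_max => //; rewrite /enc_derivation size_enc_list /D' -cats1 map_cat sumn_cat.
  rewrite /= addn0 /enc_sequent size_cat size_enc_list.
  have : 2 ^ w <= sumn [seq (size (enc_form A)).+1 | A <- premises].
    rewrite -[X in X <= _](size_iota 0) -(size_map clause (iota _ _)) -/premises.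
    by elim: premises => //= A l; lia.
  by rewrite -[S.1]/premises; lia.
exists D'.
  split; first split; first by exists D.
    apply/LK_lines_rcons; split=> //; right; exists [:: S]; last by move=> ? [<-|[]].
    exact: LK_struct.
  move=> T A /okD'[_ /allP bT] /InP /bT /andP[_]; exact: flat_depth.
rewrite /enc_derivation size_enc_list ltnS.
have sD' : size D' <= ((w + 4) ^ (2 ^ w) * conflict_cost.+1).+1 by rewrite size_rcons.
apply: leq_trans (leq_mul sD' (leqnn _)).
elim: D' {wD' sD'} okD' => //= T l IHl okl; rewrite mulSn leq_add //.
  by rewrite ltnS; apply: size_enc_sequent_le; apply: okl; left.
by apply: IHl => T' T'l; apply: okl; right.
Qed.

End ClauseFamily.

Import Order.TTheory GRing.Theory Num.Theory.

(** * Independent samples *)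

Section Expectation.

Local Open Scope ring_scope.

Variables (R : realType) (T : finType) (D : {ffun T -> R}).

Hypotheses (D_ge0 : forall x, 0 <= D x) (D_sum1 : \sum_x D x = 1).

(** An iterated sum instead of a sum over tuples, so that one coordinate can be averaged while the
    others are fixed. *)
Fixpoint expect (k : nat) (G : seq T -> R) : R :=
  if k is k'.+1 then \sum_x D x * expect k' (fun l => G (x :: l)) else G [::].

Lemma eq_expect k G G' : (forall l, size l = k -> G l = G' l) ->
  expect k G = expect k G'.
Proof.
elim: k G G' => [|k IHk] G G' GG' /=; first exact: GG'.
by apply: eq_bigr => x _; congr (_ * _); apply: IHk => l sl; rewrite GG' //= sl.
Qed.

Lemma expect_le k G G' : (forall l, size l = k -> all (fun x => D x != 0) l -> G l <= G' l) ->
  expect k G <= expect k G'.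
Proof.
elim: k G G' => [|k IHk] G G' GG' /=; first exact: GG'.
apply: ler_sum => x _; have [->|Dx] := eqVneq (D x) 0; first by rewrite !mul0r.
by apply: ler_wpM2l => //; apply: IHk => l sl Dl; apply: GG'; rewrite /= ?sl ?Dx.
Qed.

Lemma expect_linear k a b G G' :
  expect k (fun l => a * G l + b * G' l) = a * expect k G + b * expect k G'.
Proof.
elim: k G G' => //= k IHk G G'.
rewrite !mulr_sumr -big_split; apply: eq_bigr => x _ /=; rewrite IHk; ring.
Qed.

Lemma expect_const k c : expect k (fun=> c) = c.
Proof.
elim: k => //= k IHk; under eq_bigr do rewrite IHk.
by rewrite -mulr_suml D_sum1 mul1r.
Qed.

Lemma expect_cat j k G :
  expect (j + k) G = expect j (fun l => expect k (fun l' => G (l ++ l'))).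
Proof. by elim: j G => //= j IHj G; apply: eq_bigr => x _; rewrite IHj. Qed.

Lemma expect_sum k (G : T -> seq T -> R) :
  \sum_x D x * expect k (G x) = expect k (fun l => \sum_x D x * G x l).
Proof.
elim: k G => //= k IHk G.
under eq_bigr do rewrite mulr_sumr.
rewrite exchange_big /=; apply: eq_bigr => y _; rewrite -IHk mulr_sumr.
by apply: eq_bigr => x _; ring.
Qed.

Lemma expect_coordinate t k G : expect (t + k.+1) G =
  expect t (fun l => expect k (fun l' => \sum_x D x * G (l ++ x :: l'))).
Proof. by rewrite expect_cat; apply: eq_expect => l _; rewrite /= expect_sum. Qed.

Lemma expect_exists k (G : seq T -> bool) : 0 < expect k (fun l => (G l)%:R) ->
  exists l, [/\ size l = k, all (fun x => D x != 0) l & G l].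
Proof.
move=> G_gt0; apply: contrapT => noG.
suff : expect k (fun l => (G l)%:R) <= expect k (fun=> 0).
  by rewrite expect_const leNgt G_gt0.
apply: expect_le => l sl Dl; case Gl: (G l) => //.
by case: noG; exists l.
Qed.

Variables (k w : nat) (eps : R) (F : nat -> seq T -> bool).

Definition survives (t : nat) (l : seq T) : bool := all (fun s => F s l) (iota 0 t).

Hypothesis halving : forall t l l', (t < k)%N -> size l = t -> size (l ++ l') = w.-1 ->
  all (fun x => D x != 0) (l ++ l') ->
  \sum_x D x * (survives t (l ++ x :: l') && ~~ F t (l ++ x :: l'))%:R <=
    2^-1 * (\sum_x D x * (survives t (l ++ x :: l'))%:R) + eps.

Lemma survives_S t l : survives t.+1 l = survives t l && F t l.
Proof. by rewrite /survives -addn1 iotaD all_cat /= andbT. Qed.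

(** If [g] is the survival probability before a round, [halving] leaves at least [g / 2 - eps], and
    the bound [2^-1 ^+ t - 2 * eps] is stable under this map. *)
Lemma expect_survives t : 0 <= eps -> (k <= w)%N -> (t <= k)%N ->
  2^-1 ^+ t - 2 * eps <= expect w (fun l => (survives t l)%:R).
Proof.
move=> eps_ge0 kw; elim: t => [|t IHt] tk.
  by rewrite expr0 /= expect_const lerBlDr lerDl mulr_ge0.
have {IHt} := IHt (ltnW tk); set g := expect w _ => IHt.
have gS : expect w (fun l => (survives t.+1 l)%:R) =
    g - expect w (fun l => (survives t l && ~~ F t l)%:R).
  rewrite -[g]mul1r -mulN1r -expect_linear; apply: eq_expect => l _.
  by rewrite survives_S mul1r mulN1r; case: survives; case: F; rewrite ?subr0 ?subrr.
suff : expect w (fun l => (survives t l && ~~ F t l)%:R) <= 2^-1 * g + eps.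
  by rewrite gS exprS; lra.
have wE : w = (t + (w - t.+1).+1)%N by have := leq_trans tk kw; lia.
have -> : 2^-1 * g + eps = expect t (fun l => expect (w - t.+1) (fun l' =>
    2^-1 * (\sum_x D x * (survives t (l ++ x :: l'))%:R) + eps * 1)).
  transitivity (expect t (fun l => 2^-1 * expect (w - t.+1) (fun l' =>
      \sum_x D x * (survives t (l ++ x :: l'))%:R) + eps * 1)).
    rewrite expect_linear expect_const mulr1.
    by rewrite -(expect_coordinate t _ (fun l => (survives t l)%:R)) -wE.
  by apply: eq_expect => l _; rewrite expect_linear expect_const.
rewrite [X in expect X _]wE expect_coordinate.
have split_all (l l' : seq T) : all (fun x => D x != 0) l -> all (fun x => D x != 0) l' ->
  all (fun x => D x != 0) (l ++ l') by rewrite all_cat => -> ->.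
apply: expect_le => l sl Dl; apply: expect_le => l' sl' Dl'; rewrite mulr1.
apply: halving; rewrite ?split_all // size_cat sl sl'.
by rewrite -subn1; move: (leq_trans tk kw); lia.
Qed.

Lemma survivor_exists : 0 <= eps -> (k <= w)%N -> 2 * eps < 2^-1 ^+ k ->
  exists l, [/\ size l = w, all (fun x => D x != 0) l & survives k l].
Proof.
move=> eps_ge0 kw eps_lt; apply: expect_exists.
by apply: lt_le_trans (expect_survives eps_ge0 kw (leqnn k)); rewrite subr_gt0.
Qed.

End Expectation.

(** * Circuits for the student *)

(** Renumbering for a circuit placed behind [d] other gates: input wires are shared and keep their
    numbers, gate wires move up. *)
Definition shift_gate (n d : nat) (g : gate) : gate :=
  let sh i := if i < n then i else i + d in
  match g with
  | GConst b => GConst b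
  | GNot i => GNot (sh i)
  | GAnd i j => GAnd (sh i) (sh j)
  | GOr i j => GOr (sh i) (sh j)
  end.

Lemma shift_gates n gs gs2 : gates_wf n gs -> gates_wf n gs2 ->
  let d := size gs in let G := gs ++ map (shift_gate n d) gs2 in
  gates_wf n G /\ forall x i, size x = n -> i < n + size gs2 ->
    nth false (wires G x) (if i < n then i else i + d) = nth false (wires gs2 x) i.
Proof.
move=> wf; elim/last_ind: gs2 => [|gs2 g IH] /=.
  rewrite cats0; split=> // x i sx; rewrite addn0 => iln; rewrite iln.
  have [j jlt jP] := on_wire_input gs iln.
  by elim/last_ind: gs {wf j jlt jP} => // gs g IHgs;
    rewrite wires_rcons nth_rcons size_wires sx ltn_addr.
rewrite gates_wf_rcons => /andP[/IH{IH}/= [wfG GP] wfg].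
set d := size gs in wfG GP *; set G := _ ++ map _ gs2 in wfG GP.
have sG : size G = d + size gs2 by rewrite size_cat size_map.
rewrite map_rcons -rcons_cat -/G; split.
  rewrite gates_wf_rcons wfG sG.
  case: g wfg => //= [i|i j|i j]; try (case/andP=> ilt jlt; apply/andP; split); try move=> ilt;
    by case: ifP; lia.
move=> x i sx; rewrite size_rcons addnS ltnS leq_eqVlt => /predU1P[->|ilt].
  rewrite ltnNge leq_addr /= !wires_rcons !nth_rcons !size_wires sx sG.
  have -> : n + size gs2 + d = n + (d + size gs2) by lia.
  rewrite !ltnn !eqxx.
  by case: g wfg => //= [a|a b|a b]; [move=> alt | case/andP=> alt blt | case/andP=> alt blt];
    rewrite !GP.
have glt : (if i < n then i else i + d) < n + (d + size gs2) by case: ifP; lia.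
by rewrite !wires_rcons !nth_rcons !size_wires sx sG glt ilt GP.
Qed.

Lemma computed_union n s1 s2 F1 F2 : computed n s1 F1 -> computed n s2 F2 ->
  computed n (s1 + s2) (fun f => F1 f \/ F2 f).
Proof.
case=> gs1 [wf1 sz1 F1P] [gs2 [wf2 sz2 F2P]].
have [wfG GP] := shift_gates wf1 wf2.
exists (gs1 ++ map (shift_gate n (size gs1)) gs2); split=> //.
  by rewrite size_cat size_map leq_add.
move=> f [/F1P|/F2P[i ilt fi]]; first exact: on_wire_cat.
exists (if i < n then i else i + size gs1).
  by rewrite size_cat size_map; case: ifP; lia.
by move=> x sx; rewrite GP // fi.
Qed.

Definition circuit_computes (n s : nat) (g : bits -> bool) : Prop :=
  computed n s (fun f => f = g).

Lemma circuit_computes_leq n s s' g : s <= s' ->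
  circuit_computes n s g -> circuit_computes n s' g.
Proof. exact: computed_leq. Qed.

Lemma circuit_computes_const n b : circuit_computes n 5 (fun=> b).
Proof.
apply: (computed_sub _ (computed_add (computed_inputs n) (gl := [:: fun=> b]) (m := 0) _)).
  by move=> f ->; right; left.
by move=> g [<-|[]]; exists [::].
Qed.

Lemma circuit_computes_op n s1 s2 (op : bool -> bool -> bool) g1 g2 :
  circuit_computes n s1 g1 -> circuit_computes n s2 g2 ->
  circuit_computes n (s1 + s2 + 20) (fun x => op (g1 x) (g2 x)).
Proof.
move=> c1 c2; apply: (computed_sub _ (computed_add (computed_union c1 c2)
  (gl := [:: fun x => op (g1 x) (g2 x)]) (m := 2) _)).
  by move=> f ->; right; left.
move=> g [<-|[]]; exists [:: g1; g2]; split=> // [f [<-|[<-|[]]]|x y _ _ xy].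
- by left.
- by right.
by rewrite (xy g1) ?(xy g2) //; [right; left | left].
Qed.

Lemma circuit_computes_has n s (I : seq nat) (g : nat -> bits -> bool) :
  (forall i, i \in I -> circuit_computes n s (g i)) ->
  circuit_computes n (size I * (s + 20) + 5) (fun x => has (fun i => g i x) I).
Proof.
elim: I => [|i I IHI] gP; first exact: circuit_computes_const.
have {IHI}cI := IHI (fun j jI => gP j (mem_behead (s := i :: I) jI)).
have := circuit_computes_op orb (gP i (mem_head _ _)) cI.
by apply: circuit_computes_leq; rewrite /= mulSn; lia.
Qed.

Lemma circuit_of_computes n s g : circuit_computes n s g ->
  exists C, [/\ circuit_wf n C, circuit_size C <= s &
    forall x, size x = n -> circuit_eval C x = g x].
Proof.
case=> gs [wf sgs /(_ g erefl)[i ilt gP]]; exists (Circuit gs i); split=> //.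
by rewrite /circuit_wf /= ilt.
Qed.

(** [tau] is a template whose entries are constant bits or positions of [x]. It describes machine
    inputs in which only a part varies. *)
Definition fill (x : bits) (tau : seq (bool + nat)) : bits :=
  [seq (match c with inl b => b | inr j => nth false x j end) | c <- tau].

Lemma fill_const x s : fill x (map inl s) = s.
Proof. by rewrite /fill -map_comp map_id. Qed.

Lemma fill_input x n : size x = n -> fill x (map inr (iota 0 n)) = x.
Proof. by move=> <-; rewrite /fill -map_comp -[RHS]take_size -(map_nth_iota0 false). Qed.

Lemma fill_cat x tau tau' : fill x (tau ++ tau') = fill x tau ++ fill x tau'.
Proof. exact: map_cat. Qed.

(** The code only interleaves constants, so the code of a template is again a template. *)
Lemma fill_enc_bits x tau : enc_bits (fill x tau) =
  fill x (rcons (flatten [seq [:: inl true; c] | c <- tau]) (inl false)).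
Proof.
rewrite /fill map_rcons map_flatten -map_comp /enc_bits /enc_list -map_comp.
by congr rcons; congr flatten; apply: eq_map.
Qed.

Lemma fill_local n tau p : all (fun c => if c is inr j then j < n else true) tau ->
  local_in n 1 (inputs n) (fun x => nth false (fill x tau) p).
Proof.
move=> /allP tauP; have [pl|pl] := ltnP p (size tau); last first.
  by exists [::]; split=> // x y _ _ _; rewrite !nth_default // size_map.
have {tauP} := tauP _ (mem_nth (inl false) pl).
case E : (nth (inl false) tau p) => [b|j] jn.
  by exists [::]; split=> // x y _ _ _; rewrite !(nth_map (inl false)) // E.
exists [:: fun x => nth false x j]; split=> // [f [<-|[]]|x y _ _ xy]; first by exists j.
by rewrite !(nth_map (inl false)) // E; apply: (xy (fun x => nth false x j)); left.
Qed.

Lemma uniform_bound (Q : nat -> nat -> Prop) k :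
  (forall j c c', c <= c' -> Q j c -> Q j c') ->
  (forall j, j < k -> exists c, Q j c) -> exists c, forall j, j < k -> Q j c.
Proof.
move=> Qmono; elim: k => [|k IHk] QP; first by exists 0.
have [c cP] := IHk (fun j jk => QP j (ltnW jk)).
have [c' c'P] := QP k (ltnSn k); exists (c + c') => j.
rewrite ltnS leq_eqVlt => /predU1P[->|jk]; first exact: Qmono (leq_addl _ _) c'P.
exact: Qmono (leq_addr _ _) (cP j jk).
Qed.

Section Student.

Variables (k : nat) (f : nat -> bits -> bits -> seq bits -> bits) (I : nat).

Hypothesis f_polytime : forall j, j < k ->
  polytime (fun u : bits * bits * seq bits => enc_strs [:: u.1.1, u.1.2 & u.2])
           (fun u => f j u.1.1 u.1.2 u.2).

(** Only the string [x] varies. Its neighbours [a1] and [a2], the proof [z] and the answers [ws] are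
    wired in as advice, with one exponent for all [k] functions. *)
Lemma student_circuits : exists c, forall j, j < k ->
  forall n L (a1 a2 z : bits) (ws : seq bits) i, i <= I ->
    size (enc_strs [:: a1 ++ nseq n false ++ a2, z & ws]) <= L ->
    circuit_computes n (L.+2 ^ c)
      (fun x => nat_of_bits (f j (a1 ++ x ++ a2) z ws) == i).
Proof.
apply: uniform_bound.
  move=> j c c' cc' cP n L a1 a2 z ws i iI sL.
  by apply: circuit_computes_leq (cP n L a1 a2 z ws i iI sL); rewrite leq_exp2l.
move=> j jk; have [c cP] := polytime_circuits I (f_polytime jk).
exists c => n L a1 a2 z ws i iI sL.
pose tau0 : seq (bool + nat) := map inl a1 ++ map inr (iota 0 n) ++ map inl a2.
pose tau := inl true :: rcons (flatten [seq [:: inl true; c] | c <- tau0]) (inl false) ++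
  map inl (enc_strs (z :: ws)).
have tau0P x : size x = n -> fill x tau0 = a1 ++ x ++ a2.
  by move=> sx; rewrite !fill_cat !fill_const fill_input.
have tauP x : size x = n -> enc_strs [:: a1 ++ x ++ a2, z & ws] = fill x tau.
  move=> sx; rewrite -tau0P // /tau.
  rewrite -[inl true :: _]/([:: inl true] ++ _) (fill_cat _ [:: _]) (fill_cat _ (rcons _ _)).
  rewrite fill_const -fill_enc_bits.
  by rewrite /enc_strs /enc_list /= rcons_cat.
have inP : all (fun c => if c is inr j then j < n else true) tau.
  have in0 : all (fun c : bool + nat => if c is inr j then j < n else true) tau0.
    rewrite !all_cat !all_map; apply/and3P; split; [exact/allP | | exact/allP].
    by apply/allP => j'; rewrite mem_iota.
  rewrite /tau /= all_cat all_rcons /= all_map; apply/andP; split; last exact/allP.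
  by elim: (tau0) in0 => //= c' tau' IH /andP[-> /IH].
have stau : size tau <= L.
  by apply: leq_trans sL; rewrite (tauP (nseq n false)) ?size_nseq // size_map.
apply: (@circuit_computes_leq _ ((size tau).+2 ^ c)).
  by case: (c) => // c0; rewrite leq_exp2r // !ltnS.
apply: (cP n (size tau) (fun x => (a1 ++ x ++ a2, z, ws)) i _ _ iI) => [x sx|p _].
  by rewrite tauP // size_map.
have [fs [sfs fsF fsP]] := fill_local p inP; exists fs; split=> // x y sx sy xy.
by rewrite !tauP // (fsP x y).
Qed.

End Student.

Lemma choose_proofs (P : proof_system) (Q : seq sequent) B :
  (forall q, List.In q Q -> exists2 pi, proves P pi (seq_form q) & size pi <= B) ->
  exists ps : seq (bits * sequent),
    [/\ map snd ps = Q, forall p, List.In p ps -> proves P p.1 (seq_form p.2) &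
        sumn [seq size p.1 | p <- ps] <= size Q * B].
Proof.
elim: Q => [|q Q IHQ] QP; first by exists [::].
have [ps [psQ psP psB]] := IHQ (fun q qQ => QP q (or_intror qQ)).
have [pi piP piB] := QP q (or_introl erefl).
exists ((pi, q) :: ps); split=> [|p [<-//|/psP//]|]; first by rewrite /= psQ.
by rewrite /= mulSn leq_add.
Qed.

Lemma leq_exp2r_weak c m n : m <= n -> m ^ c <= n ^ c.
Proof. by case: c => // c mn; rewrite leq_exp2r. Qed.

(** * Polynomial-size P-proofs of the disjunction of the negated N_i *)

Section ShortProofs.

Variables (lU lV : nat -> nat) (FU FV : nat -> formula) (w : nat).

Hypotheses (lU_poly : poly_bounded lU) (lV_poly : poly_bounded lV).
Hypotheses (FU_poly : poly_bounded (fun n => size (enc_form (FU n))))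
           (FV_poly : poly_bounded (fun n => size (enc_form (FV n)))).

Lemma ysize_poly : poly_bounded (fun n => ysize w (lU n) (lV n)).
Proof.
apply: poly_bounded_add; first exact: poly_bounded_const.
apply: poly_bounded_mul; first exact: poly_bounded_const.
exact: poly_bounded_add.
Qed.

Lemma natoms_poly : poly_bounded (fun n => natoms w n (lU n) (lV n)).
Proof.
apply: poly_bounded_add; apply: poly_bounded_mul; try exact: poly_bounded_const.
  exact: poly_bounded_id.
exact: ysize_poly.
Qed.

Lemma poly_bounded_S g : poly_bounded g -> poly_bounded (fun n => (g n).+1).
Proof.
move=> pg; apply: (@poly_bounded_le _ (fun n => g n + 1)) => [n|]; first by rewrite addn1.
exact/poly_bounded_add/poly_bounded_const.
Qed.

Lemma form_bound_poly : poly_bounded (fun n => form_bound w n (lU n) (lV n) (FU n) (FV n)).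
Proof.
have pa := natoms_poly; have pc := poly_bounded_const.
have ps : poly_bounded (fun n => (size (enc_form (FU n)) + size (enc_form (FV n))) *
    (natoms w n (lU n) (lV n)).+1).
  by apply: poly_bounded_mul; [apply: poly_bounded_add | apply: poly_bounded_S].
rewrite /form_bound; apply: poly_bounded_add => //.
apply: poly_bounded_add; first apply: poly_bounded_add => //.
  apply: poly_bounded_mul; first exact: pc.
  by apply: poly_bounded_add => //.
apply: poly_bounded_mul; first exact: pc.
by apply: poly_bounded_mul => //; apply: poly_bounded_add.
Qed.

Lemma derivation_bound_poly :
  poly_bounded (fun n => derivation_bound w n (lU n) (lV n) (FU n) (FV n)).
Proof.
have pf := form_bound_poly; have pc := poly_bounded_const.
rewrite /derivation_bound; apply: poly_bounded_S; apply: poly_bounded_mul.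
  apply: poly_bounded_S; apply: poly_bounded_mul; first exact: pc.
  apply: poly_bounded_S; rewrite /conflict_cost.
  apply: poly_bounded_add; last exact: pc.
  apply: poly_bounded_mul; first exact: pc.
  by apply: poly_bounded_S; apply: poly_bounded_mul.
do 3!apply: (poly_bounded_S); apply: poly_bounded_mul; first exact: pc.
exact: poly_bounded_S.
Qed.

Variable P : proof_system.

Hypotheses (P_contains : contains_LK32 P)
           (short_proofs : short_disjointness_proofs P lU lV FU FV).
Hypotheses (FU_cnf : forall n, is_3CNF (FU n) /\ {subset atoms (FU n) <= iota 0 (n + lU n)})
           (FV_cnf : forall n, is_3CNF (FV n) /\ {subset atoms (FV n) <= iota 0 (n + lV n)}).

Hypothesis w_ge4 : 4 <= w.

Lemma premises_refuted : exists B : nat -> nat, poly_bounded B /\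
  forall n, exists2 pi,
    proves P pi (disj (map Not (premises w n (lU n) (lV n) (FU n) (FV n)))) & size pi <= B n.
Proof.
have [_ [c1 ext]] := P_contains; have [c2 short] := short_proofs.
(* The triples [(i, i', j)] with bits 1 and 0 at [j]. Their number depends on [w] only, so one short
   disjointness proof can be spent on each. *)
pose conflicts := [seq t <-
  [seq (p, j) | p <- [seq (i, i') | i <- iota 0 (2 ^ w), i' <- iota 0 (2 ^ w)],
     j <- iota 0 w] | bit_of t.1.1 t.2 && ~~ bit_of t.1.2 t.2].
pose fb n := form_bound w n (lU n) (lV n) (FU n) (FV n).
pose B1 n := pbound c2 (n + (9 + 2 * fb n)).
pose B n := pbound c1 (size conflicts * B1 n + derivation_bound w n (lU n) (lV n) (FU n) (FV n)).
exists B; split.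
  apply: poly_bounded_pbound; apply: poly_bounded_add; last exact: derivation_bound_poly.
  apply: poly_bounded_mul; first exact: poly_bounded_const.
  apply: poly_bounded_pbound; apply: poly_bounded_add; first exact: poly_bounded_id.
  apply: poly_bounded_add; first exact: poly_bounded_const.
  by apply: poly_bounded_mul; [exact: poly_bounded_const | exact: form_bound_poly].
move=> n; have [cnfU atU] := FU_cnf n; have [cnfV atV] := FV_cnf n.
pose lt i j := lit w n (lU n) (lV n) (FU n) (FV n) i j.
pose Q : seq sequent := [seq ([:: lt t.1.2 t.2; lt t.1.1 t.2], [::]) | t <- conflicts].
have conflictsP i i' j : i < 2 ^ w -> i' < 2 ^ w -> j < w -> bit_of i j -> ~~ bit_of i' j ->
    (i, i', j) \in conflicts.
  move=> iw i'w jw bi bi'; rewrite mem_filter /= bi bi' /=.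
  by apply: allpairs_f; [apply: allpairs_f|]; rewrite mem_iota.
have [|ps [psQ psP psB]] := @choose_proofs P Q (B1 n).
  move=> _ /In_map_seq[[[i i'] j] /InP + ->] /=; rewrite mem_filter.
  case/andP=> /= /andP[bi /negbTE bi'] /allpairsP[[[a a'] b] [/= + + [ai ai' bj]]].
  rewrite -{a}ai -{a'}ai' -{b}bj mem_iota => + /= jw.
  case/allpairsP=> -[a a'] [/=]; rewrite !mem_iota => /= iw i'w [ai ai'].
  rewrite -{a}ai in iw; rewrite -{a'}ai' in i'w.
  have ii' : i' != i by apply: contraFneq bi' => ->.
  have uniq_b := @blocks_uniq w n (lU n) (lV n) i' i j ii' jw.
  have [||||pi piP piB] := short n (xblock n j) (wblock w n (lU n) (lV n) i' j)
    (wblock w n (lU n) (lV n) i j).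
  - by rewrite size_iota.
  - by rewrite size_iota /wit_len bi'.
  - by rewrite size_iota /wit_len bi.
  - exact: uniq_b.
  (* A sequent with both literals on the left stands for the disjunction of their negations;
     [lit i' j] comes first because it is the one about U. *)
  have E : disjointness_formula (FU n) (FV n) (xblock n j) (wblock w n (lU n) (lV n) i' j)
    (wblock w n (lU n) (lV n) i j) = seq_form ([:: lt i' j; lt i j], [::]).
    by rewrite /lt /lit /wit_form bi bi'.
  rewrite E in piP piB; exists pi => //; apply: leq_trans piB _.
  rewrite /B1 /pbound leq_add2r; apply: leq_exp2r_weak; rewrite leq_add2l.
  have := size_enc_lit_bound n (lU n) (lV n) cnfU cnfV i'w jw.
  have := size_enc_lit_bound n (lU n) (lV n) cnfU cnfV iw jw.
  by rewrite /seq_form [disj _]/= size_enc_or /= -/(lt i j) -/(lt i' j) -/(fb n); lia.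
have [|D DP sD] := @clause_derivation w n (lU n) (lV n) _ _ cnfU cnfV w_ge4 (map snd ps).
  move=> i i' j iw i'w jw bi bi'; rewrite psQ; apply/In_map_seq.
  by exists (i, i', j) => //; apply/InP/conflictsP.
have [pi + piB] := ext ps D _ psP DP; rewrite /seq_form cats0 => piP.
exists pi => //; apply: leq_trans piB _; rewrite /B /pbound leq_add2r.
by apply: leq_exp2r_weak; rewrite leq_add // (leq_trans psB) // size_map.
Qed.

End ShortProofs.

(** * The student-teacher game *)

Lemma nth_flatten_val n (l : seq (n.-tuple bool)) x0 j p : j < size l -> p < n ->
  nth false (flatten (map val l)) (j * n + p) = nth false (nth x0 l j) p.
Proof.
elim: l j => [|x l IHl] [|j] //= jl pn; rewrite nth_cat size_tuple.
  by rewrite mul0n add0n pn.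
by rewrite mulSn -addnA ltnNge leq_addr /= addKn IHl.
Qed.

Lemma size_flatten_val n (l : seq (n.-tuple bool)) : size (flatten (map val l)) = size l * n.
Proof. by elim: l => //= x l IHl; rewrite size_cat size_tuple IHl. Qed.

Lemma kpt_roundsS f a z xs Ay bs r j ws : kpt_rounds f a z xs Ay bs r.+1 j ws ->
  let i := nat_of_bits (f j a z ws) in let Ai := nth (Or [::], [::]) Ay i in
  i < size Ay /\ (TAUT (plug xs a Ai.1) \/
    (eval (assign (xs ++ Ai.2) (a ++ nth [::] bs i)) Ai.1 = false ->
     kpt_rounds f a z xs Ay bs r j.+1 (rcons ws (nth [::] bs i)))).
Proof. by []. Qed.

Section Game.

Variables (w n lu lv : nat) (fU fV : formula).
Variables (k : nat) (f : nat -> bits -> bits -> seq bits -> bits) (z : bits).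

Notation T := (n.-tuple bool).

(* [al x] says that x lies in U. *)
Variables (al : T -> bool) (wit : T -> bits) (supp : pred T) (x0 : T).

Definition joined (l : seq T) : bits := flatten (map val l).

(* The teacher answers a false clause by witnessing the first string on which
   it errs. *)
Definition first_diff (l : seq T) (i : nat) : nat :=
  find (fun j => bit_of i j != al (nth x0 l j)) (iota 0 w).

(** If [i] errs nowhere, [first_diff] is [w]: no selector is set and the answer is junk. *)
Definition response (l : seq T) (i : nat) : bits :=
  teacher_bits w lu lv (first_diff l i) (wit (nth x0 l (first_diff l i))).

Fixpoint history (l : seq T) (t : nat) : seq nat :=
  if t is t'.+1 then
    rcons (history l t')
      (nat_of_bits (f t' (joined l) z (map (response l) (history l t'))))
  else [::].

Definition query (l : seq T) (t : nat) : nat :=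
  nat_of_bits (f t (joined l) z (map (response l) (history l t))).

(* The query of round [t] errs on one of the first [t.+1] strings; as long as
   this happens, only witnesses for these strings are revealed. *)
Definition refuted (t : nat) (l : seq T) : bool :=
  has (fun j => bit_of (query l t) j != al (nth x0 l j)) (iota 0 t.+1).

Lemma size_history l t : size (history l t) = t.
Proof. by elim: t => //= t IHt; rewrite size_rcons IHt. Qed.

Lemma first_diff_lt l i t :
  has (fun j => bit_of i j != al (nth x0 l j)) (iota 0 t.+1) -> t < w ->
  first_diff l i <= t /\ bit_of i (first_diff l i) != al (nth x0 l (first_diff l i)).
Proof.
move=> h tw; rewrite /first_diff -{1 2 3}(subnKC tw) iotaD find_cat h.
have := h; rewrite has_find size_iota => lt; split=> //.
by have := nth_find 0 h; rewrite nth_iota.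
Qed.

Definition display : seq (formula * seq nat) :=
  [seq (Not (clause w n lu lv fU fV i), yvars w n lu lv i) | i <- iota 0 (2 ^ w)].

Hypotheses (cnfU : is_3CNF fU) (cnfV : is_3CNF fV).
Hypotheses (atomsU : {subset atoms fU <= iota 0 (n + lu)})
           (atomsV : {subset atoms fV <= iota 0 (n + lv)}).
Hypothesis witP : forall x, supp x ->
  eval (nth false (val x ++ wit x)) (if al x then fU else fV).
Hypotheses (k_gt0 : 0 < k) (kw : k <= w).

(** The answer to [i] depends on [l] and [i] but not on the round, so the whole strategy of the
    teacher is listed in advance as the assignments of [kpt_rounds]. *)
Definition interpolated (l : seq T) : Prop :=
  kpt_rounds f (joined l) z (xvars w n) display (mkseq (response l) (2 ^ w)) k.-1 0 [::].

Lemma refuted_clause l t : size l = w -> all supp l -> t < w -> refuted t l ->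
  eval (assign (xvars w n ++ yvars w n lu lv (query l t)) (joined l ++ response l (query l t)))
    (Not (clause w n lu lv fU fV (query l t))) = false.
Proof.
move=> sl sup tw /first_diff_lt/(_ tw)[]; rewrite /response.
set i := query l t; set j := first_diff l i => jt bj; apply/negbTE/negPn.
have jw : j < w by apply: leq_ltn_trans tw.
apply: (eval_clause cnfU cnfV atomsU atomsV (aj := nth x0 l j)) => //.
- by rewrite size_flatten_val sl.
- exact: size_tuple.
- by move=> p pn; apply: nth_flatten_val => //; rewrite sl.
have /witP : supp (nth x0 l j) by move/all_nthP: sup => /(_ x0 j); rewrite sl => /(_ jw).
by move: bj; rewrite /wit_form; case: bit_of; case: (al _).
Qed.

(** A refuted query is answered by a genuine counterexample, which rules out the tautology
    alternative and forces the next round; the answers accumulated are those of [history]. *)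
Lemma interpolated_rounds l t : size l = w -> all supp l -> interpolated l -> t < k ->
  survives refuted t l ->
  kpt_rounds f (joined l) z (xvars w n) display (mkseq (response l) (2 ^ w))
    (k.-1 - t) t (map (response l) (history l t)).
Proof.
move=> sl sup kpt0; elim: t => [|t IHt] tk sur; first by rewrite subn0.
move: sur; rewrite survives_S => /andP[sur ref].
have := IHt (ltnW tk) sur; have -> : k.-1 - t = (k.-1 - t.+1).+1 by lia.
move/kpt_roundsS; rewrite -/(query l t) size_map size_iota => -[iw].
rewrite (nth_map 0) ?size_iota // nth_iota // add0n nth_mkseq // => kpt.
have ev := refuted_clause sl sup (leq_trans (ltnW tk) kw) ref.
case: kpt => [|/(_ ev)]; last by rewrite -map_rcons.
by move/(plug_not_TAUT _ ev) => []; rewrite size_flatten_val sl size_iota.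
Qed.

Lemma interpolated_query l t : size l = w -> all supp l -> interpolated l -> t < k ->
  survives refuted t l -> query l t < 2 ^ w.
Proof.
move=> sl sup kpt tk sur; have := interpolated_rounds sl sup kpt tk sur.
by case: (k.-1 - t) => [|r] /= [+ _]; rewrite size_map size_iota.
Qed.

(** The last round has no continuation, so its query would have to give a tautology although it is
    refuted. *)
Lemma interpolated_not_survives l : size l = w -> all supp l -> interpolated l ->
  ~~ survives refuted k l.
Proof.
move=> sl sup kpt; apply/negP; rewrite -(prednK k_gt0) survives_S => /andP[sur ref].
have tk : k.-1 < k by rewrite prednK.
have iw := interpolated_query sl sup kpt tk sur.
have := interpolated_rounds sl sup kpt tk sur; rewrite subnn /= -/(query l k.-1) => -[_].
rewrite (nth_map 0) ?size_iota // nth_iota // add0n /= => -[|//].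
have ev := refuted_clause sl sup (leq_trans tk kw) ref.
by apply: (plug_not_TAUT _ ev); rewrite size_flatten_val sl size_iota.
Qed.

Section Predictor.

Variables (t : nat) (l l' : seq T) (b : bool).

Hypotheses (tk : t < k) (size_l : size l = t) (size_ll' : size (l ++ l') = w.-1).

Definition known_response (i : nat) : bits := response (l ++ x0 :: l') i.

(* Guesses whether the string [x] in position [t] lies in U; the answers given
   before round [t] concern only the strings of [l], whose witnesses are fixed. *)
Fixpoint predictor (r : nat) (hist : seq nat) (x : bits) : bool :=
  has (fun i =>
    (nat_of_bits (f (size hist) (joined l ++ x ++ joined l') z (map known_response hist)) == i)
    && (if r is r'.+1 then
          if has (fun j => bit_of i j != al (nth x0 l j)) (iota 0 (size hist).+1)
          then predictor r' (rcons hist i) x else b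
        else bit_of i t)) (iota 0 (2 ^ w)).

Lemma has_diff_eq (x : T) i s : s <= t ->
  has (fun j => bit_of i j != al (nth x0 l j)) (iota 0 s) =
  has (fun j => bit_of i j != al (nth x0 (l ++ x :: l') j)) (iota 0 s).
Proof.
move=> st; apply: eq_in_has => j; rewrite mem_iota add0n => /= js.
by rewrite nth_cat size_l (leq_trans js st).
Qed.

(** Each query before round [s] errs on a string of position below [s], hence in [l]. The first
    error and its witness are therefore the same with [x0] in the place of [x]. *)
Lemma known_responseE (x : T) s : s <= t -> survives refuted s (l ++ x :: l') ->
  map known_response (history (l ++ x :: l') s) =
  map (response (l ++ x :: l')) (history (l ++ x :: l') s).
Proof.
set L := l ++ x :: l'; elim: s => //= s IHs st; rewrite survives_S => /andP[sur ref].
rewrite !map_rcons IHs ?(ltnW st) //; congr rcons.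
rewrite -/(query L s); set i := query L s.
have sw : s < w by apply: leq_trans kw; apply: leq_trans tk; apply: leqW.
have {}ref : has (fun j => bit_of i j != al (nth x0 L j)) (iota 0 s.+1) := ref.
have [fd _] := first_diff_lt ref sw.
have ref0 : has (fun j => bit_of i j != al (nth x0 (l ++ x0 :: l') j)) (iota 0 s.+1).
  by rewrite -has_diff_eq // (has_diff_eq x).
have [fd0 _] := first_diff_lt ref0 sw.
have E : first_diff (l ++ x0 :: l') i = first_diff L i.
  rewrite /first_diff -(subnKC sw) iotaD !find_cat ref0 ref.
  apply: eq_in_find => j; rewrite mem_iota add0n => /= js.
  by rewrite !nth_cat size_l (leq_trans js st).
rewrite /known_response /response E; congr (teacher_bits _ _ _ _ (wit _)).
by rewrite !nth_cat size_l (leq_ltn_trans fd st).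
Qed.

(** [l] alone decides whether a query before round [t] is refuted, so the predictor replays the game
    faithfully and falls back on [b] at the first query that is not. *)
Lemma predictorE (x : T) r s : s + r = t -> all supp (l ++ x :: l') ->
  interpolated (l ++ x :: l') -> survives refuted s (l ++ x :: l') ->
  predictor r (history (l ++ x :: l') s) x =
    if survives refuted t (l ++ x :: l') then bit_of (query (l ++ x :: l') t) t else b.
Proof.
set L := l ++ x :: l' => + sup kpt.
have sL : size L = w.
  move: size_ll'; rewrite /L !size_cat /= addnS => ->.
  by rewrite prednK // (leq_trans k_gt0).
have jL : joined l ++ x ++ joined l' = joined L by rewrite /joined map_cat flatten_cat.
elim: r s => [|r IHr] s srt sur.
  rewrite addn0 in srt; rewrite {s}srt in sur *.
  rewrite /= size_history known_responseE // jL sur -/(query L t).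
  have qw := interpolated_query sL sup kpt tk sur.
  apply/hasP/idP => [[i _ /andP[/eqP<-]]//|bt].
  by exists (query L t); rewrite ?mem_iota ?eqxx.
have st : s < t by rewrite -srt addnS ltnS leq_addr.
rewrite [LHS]/= size_history known_responseE // ?(ltnW st) // jL -/(query L s).
have qw := interpolated_query sL sup kpt (ltn_trans st tk) sur.
(* In the disjunction over all possible indices, only the actual query contributes. *)
transitivity (if refuted s L then predictor r (rcons (history L s) (query L s)) x else b).
  rewrite /refuted -has_diff_eq //; set body := (X in _ = X).
  apply/hasP/idP => [[i _ /andP[/eqP<-]]//|bt].
  by exists (query L s); rewrite ?mem_iota ?eqxx.
have [ref|nref] := boolP (refuted s L).
  by rewrite -[rcons _ _]/(history L s.+1) IHr ?addSnnS // survives_S sur.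
have /negbTE-> // : ~~ survives refuted t L.
apply: contra nref => /allP; apply.
by rewrite mem_iota.
Qed.

(** [r] is the number of rounds still to be replayed. The 45 pays for two connectives at 20 each and
    a constant at 5. *)
Fixpoint predictor_cost (E r : nat) : nat :=
  2 ^ w * (E + (if r is r'.+1 then predictor_cost E r' else 0) + 45) + 5.

(** Branching over all [2 ^ w] possible queries makes the history a constant on each branch. The
    predictor is thus a tree of constant size whose nodes use circuits for the student. *)
Lemma predictor_circuits E r hist : size hist + r = t ->
  (forall hist i, size hist <= t -> i < 2 ^ w -> circuit_computes n E (fun x =>
    nat_of_bits (f (size hist) (joined l ++ x ++ joined l') z (map known_response hist)) == i)) ->
  circuit_computes n (predictor_cost E r) (predictor r hist).
Proof.
move=> + EP; elim: r hist => [|r IHr] hist hr.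
  have -> : predictor_cost E 0 = size (iota 0 (2 ^ w)) * (E + 5 + 20 + 20) + 5.
    by rewrite size_iota /=; lia.
  apply: (circuit_computes_has (g := fun i x => _ && _)) => i; rewrite mem_iota => /= iw.
  apply: (circuit_computes_op andb (EP _ _ _ iw) (circuit_computes_const _ _)).
  by rewrite -hr leq_addr.
have -> : predictor_cost E r.+1 =
    size (iota 0 (2 ^ w)) * (E + (predictor_cost E r + 5) + 20 + 20) + 5.
  by rewrite size_iota /=; congr (_ * _ + _); lia.
pose g i x :=
  (nat_of_bits (f (size hist) (joined l ++ x ++ joined l') z (map known_response hist)) == i)
  && (if has (fun j => bit_of i j != al (nth x0 l j)) (iota 0 (size hist).+1)
      then predictor r (rcons hist i) x else b).
apply: (circuit_computes_has (g := g)) => i; rewrite mem_iota add0n => /andP[_ iw].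
apply: (circuit_computes_op andb (EP _ _ _ iw)); first by rewrite -hr leq_addr.
case: (has _ (iota 0 (size hist).+1)); last first.
  by apply: (circuit_computes_leq _ (circuit_computes_const _ _)); rewrite leq_addl.
apply: circuit_computes_leq (leq_addr _ _) _.
by apply: IHr; rewrite size_rcons addSnnS.
Qed.

End Predictor.

End Game.

(** * Final size estimates and the distinguishing circuit *)

Lemma size_enc_strs_le l M : (forall s, s \in l -> size s <= M) ->
  size (enc_strs l) <= (size l * (2 * M).+2).+1.
Proof.
move=> lM; apply: size_enc_list_le => s /lM sM.
by rewrite size_enc_bits ltnS leq_mul2l sM orbT.
Qed.

Lemma size_enc_nats_le l M : (forall p, p \in l -> p <= M) ->
  size (enc_nats l) <= (size l * M.+2).+1.
Proof. by move=> lM; apply: size_enc_list_le => p /lM; rewrite size_enc_nat. Qed.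

Lemma predictor_cost_poly w E r : poly_bounded E ->
  poly_bounded (fun n => predictor_cost w (E n) r).
Proof.
move=> pE; have pc := poly_bounded_const; elim: r => [|r IHr] /=;
  apply: poly_bounded_add (pc 5); apply: poly_bounded_mul (pc _) _;
  apply: poly_bounded_add (pc 45); exact: poly_bounded_add.
Qed.

Lemma predictor_cost_leq w E r r' : r <= r' -> predictor_cost w E r <= predictor_cost w E r'.
Proof.
have step s : predictor_cost w E s <= predictor_cost w E s.+1.
  elim: s => [|s IHs]; rewrite leq_add2r leq_mul2l leq_add2r leq_add2l ?orbT //.
  by rewrite [_ <= _]IHs orbT.
by move=> /subnK <-; elim: (r' - r) => // d /leq_trans; apply; apply: step.
Qed.

Section HalfAdvantage.

Local Open Scope ring_scope.

(** Off [S] exactly one of the guesses [b = true] and [b = false] is right; on [S] without [F] both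
    predictors are right. Adding the two success probabilities gives at least [Pr[~ S] + 2 *
    Pr[S, ~ F]], and by hypothesis at most [1 + 2 * eps]. *)
Lemma half_advantage (R : realType) (T : finType) (D : T -> R) (eps : R)
    (S F al : pred T) (y : bool -> T -> bool) :
  (forall x, 0 <= D x) -> \sum_x D x = 1 ->
  (forall b x, D x != 0 -> S x -> ~~ F x -> y b x = al x) ->
  (forall b x, D x != 0 -> ~~ S x -> y b x = b) ->
  (forall b, \sum_x D x * (y b x == al x)%:R <= 2^-1 + eps) ->
  \sum_x D x * (S x && ~~ F x)%:R <= 2^-1 * (\sum_x D x * (S x)%:R) + eps.
Proof.
move=> D0 D1 yS yNS yP.
suff : \sum_x D x * (S x && ~~ F x)%:R * 2 <=
    \sum_x D x * (y true x == al x)%:R + \sum_x D x * (y false x == al x)%:R -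
    \sum_x D x + \sum_x D x * (S x)%:R.
  by rewrite D1 -mulr_suml; move: (yP true) (yP false); lra.
rewrite -big_split -sumrB -big_split; apply: ler_sum => x _ /=.
have [->|Dx] := eqVneq (D x) 0; first by rewrite !mul0r !addr0 subrr.
have := D0 x; case Sx: (S x) => /=; last first.
  by rewrite !yNS ?Sx //; case: (al x); rewrite ?eqxx /=; lra.
case Fx: (F x) => /=; last by rewrite !yS ?Sx ?Fx // eqxx /=; lra.
by case: eqP; case: eqP => /=; lra.
Qed.

End HalfAdvantage.

Section Display.

Variables (w n lu lv : nat) (fU fV : formula).

Hypotheses (cnfU : is_3CNF fU) (cnfV : is_3CNF fV).
Hypotheses (atomsU : {subset atoms fU <= iota 0 (n + lu)})
           (atomsV : {subset atoms fV <= iota 0 (n + lv)}).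
Definition part_bound (B : nat) : nat :=
  B + (form_bound w n lu lv fU fV).+2
  + ((w * n + ysize w lu lv) * (natoms w n lu lv).+2).+1.

Lemma size_displayed_proof pi B : size pi <= B ->
  size (displayed_proof pi (xvars w n) (display w n lu lv fU fV)) <=
    ((2 + 2 * 2 ^ w) * (2 * part_bound B).+2).+1.
Proof.
move=> piB; rewrite /displayed_proof; set parts := flatten _.
have sparts : size parts = 2 * 2 ^ w.
  rewrite /parts /display -map_comp size_flatten /shape -map_comp.
  by rewrite -[X in 2 * X](size_iota 0); elim: (iota 0 _) => //= i s ->; lia.
rewrite -sparts; apply: size_enc_strs_le => s; rewrite !inE => /or3P[/eqP->|/eqP->|].
- by apply: leq_trans piB _; rewrite /part_bound -addnA leq_addr.
- rewrite /part_bound; apply: leq_trans (leq_addl _ _).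
  apply: leq_trans (size_enc_nats_le (M := natoms w n lu lv) _) _.
    by move=> p; rewrite mem_iota /natoms; lia.
  by rewrite size_iota ltnS leq_mul2r leq_addr orbT.
case/flattenP=> _ /mapP[_ /mapP[i + ->] ->]; rewrite mem_iota => /= iw.
rewrite !inE => /orP[/eqP->|/eqP->].
  apply: (@leq_trans (form_bound w n lu lv fU fV).+2).
    exact: (size_enc_clause n lu lv cnfU cnfV iw).
  by rewrite /part_bound -addnA addnCA leq_addr.
rewrite /part_bound; apply: leq_trans (leq_addl _ _).
apply: leq_trans (size_enc_nats_le (M := natoms w n lu lv) _) _.
  by move=> p /(yvars_natoms iw)/ltnW.
by rewrite size_iota ltnS leq_mul2r leq_addl orbT.
Qed.

Lemma size_response (al : n.-tuple bool -> bool) wit x0 l i :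
  size (response w lu lv al wit x0 l i) = ysize w lu lv.
Proof. exact: size_mkseq. Qed.

Lemma kpt_interpolated (P : proof_system) f k pi (al : n.-tuple bool -> bool) wit x0 l :
  (forall (pi : bits) (xs : seq nat) (Ay : seq (formula * seq nat)),
     uniq (xs ++ flatten (map snd Ay)) ->
     (forall u, List.In u Ay -> {subset atoms u.1 <= xs ++ u.2}) ->
     proves P pi (disj (map fst Ay)) ->
     forall (a : bits) (bs : seq bits),
       size a = size xs -> map size bs = [seq size u.2 | u <- Ay] ->
       kpt_rounds f a (displayed_proof pi xs Ay) xs Ay bs k.-1 0 [::]) ->
  proves P pi (disj (map Not (premises w n lu lv fU fV))) -> size l = w ->
  interpolated w lu lv fU fV k f
    (displayed_proof pi (xvars w n) (display w n lu lv fU fV)) al wit x0 l.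
Proof.
move=> kpt piP sl; apply: kpt.
- by rewrite /display -map_comp vars_uniq.
- by move=> _ /In_map_seq[i _ ->] /=; apply: atoms_clause.
- by rewrite /display -map_comp -[map _ _](map_comp Not (clause w n lu lv fU fV)) in piP *.
- by rewrite size_flatten_val sl size_iota.
rewrite /display -!map_comp; apply: eq_map => i /=.
by rewrite size_response size_iota.
Qed.

End Display.

Lemma membership_witness (U : set bits) (RU : bits -> bits -> bool) lU FU n a :
  NP_given_by U RU -> translates RU lU FU -> size a = n -> U a ->
  exists b, eval (nth false (a ++ b)) (FU n).
Proof.
case=> _ _ UP [_ _ [wit witP]] sa /UP[y Ray].
by have /(witP n a y sa)[b [_ _ ev]] := Ray; exists b.
Qed.

Lemma translation_poly R l F : translates R l F ->
  poly_bounded l /\ poly_bounded (fun n => size (enc_form (F n))).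
Proof.
by case=> [[c cP] _ _]; split; apply: poly_bounded_le (poly_bounded_pbound c poly_bounded_id) => n;
  have [] := cP n.
Qed.

Section Distinguisher.

Local Open Scope ring_scope.

(** Without such a circuit every round satisfies the halving inequality, so some tuple in the
    support survives all [k] rounds, which interpolation forbids. *)
Lemma student_distinguishes (R : realType) (U V : set bits) (w n lu lv : nat)
    (fU fV : formula) (k E : nat) (f : nat -> bits -> bits -> seq bits -> bits) (z : bits)
    (D : {ffun n.-tuple bool -> R}) (eps : R) :
  is_3CNF fU -> is_3CNF fV ->
  {subset atoms fU <= iota 0 (n + lu)} -> {subset atoms fV <= iota 0 (n + lv)} ->
  (forall x, U x -> ~ V x) ->
  (forall x : n.-tuple bool, U x -> exists b, eval (nth false (val x ++ b)) fU) ->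
  (forall x : n.-tuple bool, V x -> exists b, eval (nth false (val x ++ b)) fV) ->
  (0 < k)%N -> (k <= w)%N ->
  (forall j a1 a2 ws i, (j < k)%N -> (size a1 + n + size a2)%N = (w * n)%N ->
     (size ws < k)%N -> (forall s, s \in ws -> size s = ysize w lu lv) -> (i < 2 ^ w)%N ->
     circuit_computes n E (fun x => nat_of_bits (f j (a1 ++ x ++ a2) z ws) == i)) ->
  (forall al wit x0 (l : seq (n.-tuple bool)), size l = w ->
     interpolated w lu lv fU fV k f z al wit x0 l) ->
  distribution_on [set x : n.-tuple bool | U x \/ V x]%classic D ->
  0 <= eps -> 2 * eps < 2^-1 ^+ k ->
  exists C : circuit,
    [/\ circuit_wf n C, (circuit_size C <= predictor_cost w E k)%N &
        2^-1 + eps <= Prob D [set x : n.-tuple bool |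
                      (U x /\ circuit_eval C x = true) \/
                      (V x /\ circuit_eval C x = false)]%classic].
Proof.
move=> cnfU cnfV atU atV disj UP VP k_gt0 kw circ kpt [D0 D1 Dsupp] eps0 eps_lt.
apply: contrapT => noC.
pose al (x : n.-tuple bool) := `[< U x >]; pose supp (x : n.-tuple bool) := D x != 0.
have suppP x : supp x -> U x \/ V x.
  by move=> Dx; have : [set x | D x != 0]%classic x by []; rewrite Dsupp.
pose wit (x : n.-tuple bool) :=
  xget [::] [set b | eval (nth false (val x ++ b)) (if al x then fU else fV)]%classic.
have witP x : supp x -> eval (nth false (val x ++ wit x)) (if al x then fU else fV).
  move=> /suppP sx; have [b bP] : exists b, eval (nth false (val x ++ b)) (if al x then fU else fV).
    rewrite /al; case: asboolP => [/UP//|nU]; apply: VP; by case: sx.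
  by rewrite /wit; case: xgetP => [b' _ //|/(_ b)].
pose x0 : n.-tuple bool := nseq_tuple n false.
pose F := refuted w lu lv f z al wit x0.
have intl (l : seq (n.-tuple bool)) : size l = w -> interpolated w lu lv fU fV k f z al wit x0 l.
  exact: kpt.
have [|l [sl Dl]] := @survivor_exists R _ D D0 D1 k w eps F _ eps0 kw eps_lt; last first.
  apply/negP.
  exact: (interpolated_not_survives cnfU cnfV atU atV witP k_gt0 kw sl Dl (intl l sl)).
move=> t l l' tk sl sll' Dll'.
have sL x : size (l ++ x :: l') = w.
  by move: sll'; rewrite !size_cat /= addnS => ->; rewrite prednK // (leq_trans k_gt0).
have DL x : D x != 0 -> all supp (l ++ x :: l').
  by move=> Dx; move: Dll'; rewrite !all_cat /= => /andP[-> ->]; rewrite !andbT.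
pose y b (x : n.-tuple bool) := predictor w lu lv f z al wit x0 t l l' b t [::] x.
have yE b x : D x != 0 -> y b x = if survives F t (l ++ x :: l')
    then bit_of (query w lu lv f z al wit x0 (l ++ x :: l') t) t else b.
  move=> Dx; apply: (predictorE cnfU cnfV atU atV witP k_gt0 kw b tk sl sll' (s := 0%N)) => //.
    exact: DL.
  exact: intl.
apply: (half_advantage (S := fun x => survives F t (l ++ x :: l'))
  (F := fun x => F t (l ++ x :: l')) (al := al) (y := y)) => //.
(* A query that is not refuted in round [t] is right on positions [0] to [t], in particular on
   [x]. *)
- move=> b x Dx Sx; rewrite yE // Sx => /hasPn/(_ t); rewrite mem_iota add0n ltnSn => /(_ isT).
  by rewrite negbK nth_cat sl ltnn subnn => /eqP.
- by move=> b x Dx /negbTE Sx; rewrite yE // Sx.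
move=> b; apply/ltW; rewrite ltNge; apply/negP => adv; apply: noC.
have circ_y : circuit_computes n (predictor_cost w E t)
    (predictor w lu lv f z al wit x0 t l l' b t [::]).
  apply: (predictor_circuits cnfU cnfV k_gt0 kw b tk sl sll') => // hist i ht iw.
  apply: circ => //.
  - exact: leq_ltn_trans tk.
  - rewrite !size_flatten_val; have := sL x0; rewrite size_cat /= => <-; lia.
  - by rewrite size_map; apply: leq_ltn_trans tk.
  by move=> s /mapP[i' _ ->]; apply: size_response.
have [C [wfC sC evC]] := circuit_of_computes circ_y.
exists C; split=> //; first by apply: leq_trans sC _; apply/predictor_cost_leq/ltnW.
(* On the support, agreeing with [al] means accepting U and rejecting V, by disjointness; other
   points have weight 0. *)
apply: le_trans adv _; rewrite /Prob [leRHS]big_mkcond le_eqVlt; apply/orP; left; apply/eqP.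
apply: eq_bigr => x _; have [->|Dx] := eqVneq (D x) 0; first by rewrite mul0r if_same.
rewrite /mkset /= evC ?size_tuple // -/(y b x).
have -> : (y b x == al x) = `[< (U x /\ y b x = true) \/ (V x /\ y b x = false) >].
  apply/idP/asboolP => [/eqP->|].
    rewrite /al; case: asboolP => Ux; [by left | right; split=> //].
    by case: (suppP x Dx).
  rewrite /al => -[[Ux ->]|[Vx ->]]; first by rewrite asboolT.
  by rewrite asboolF // => /disj.
by case: asbool; rewrite /= ?mulr1 ?mulr0.
Qed.

End Distinguisher.

Lemma cnf_of_translation R l F : translates R l F ->
  forall n, is_3CNF (F n) /\ {subset atoms (F n) <= iota 0 (n + l n)}.
Proof. by case. Qed.

(** Already [n >= 2 ^ k.+2] gives [2 * eps <= 2^-1 ^+ k.+1], which is strictly below [2^-1 ^+ k]. *)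
Lemma inverse_power_small (R : realType) k c n : (2 ^ k.+2 <= n)%N -> (0 < c)%N ->
  (0 <= (n%:R ^+ c)^-1 :> R)%R /\ (2 * (n%:R ^+ c)^-1 < 2^-1 ^+ k :> R)%R.
Proof.
move=> kn c0; have n_gt0 : (0 < n)%N by apply: leq_trans kn; rewrite expn_gt0.
have le_nc : ((2 ^ k.+2)%:R <= n%:R ^+ c :> R)%R.
  rewrite -natrX ler_nat (leq_trans kn) //; case: c c0 => // c _.
  by rewrite expnS leq_pmulr // expn_gt0 n_gt0.
have p_gt0 : (0 < (2 ^ k.+2)%:R :> R)%R by rewrite ltr0n expn_gt0.
split; first by rewrite invr_ge0 exprn_ge0 // ler0n.
have : ((n%:R ^+ c)^-1 <= ((2 ^ k.+2)%:R)^-1 :> R)%R.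
  by rewrite lef_pV2 // posrE // (lt_le_trans p_gt0).
have -> : (((2 ^ k.+2)%:R)^-1 = 2^-1 * (2^-1 * 2^-1 ^+ k) :> R)%R.
  by rewrite natrX -exprVn !exprS.
have : (0 < 2^-1 ^+ k :> R)%R by rewrite exprn_gt0 // invr_gt0 ltr0n.
by lra.
Qed.

Theorem mainTheorem1 (R : realType) (P : proof_system)
    (U V : set bits) (RU RV : bits -> bits -> bool)
    (lU lV : nat -> nat) (FU FV : nat -> formula)
    (P_contains : contains_LK32 P)
    (U_NP : NP_given_by U RU) (V_NP : NP_given_by V RV)
    (FU_translates : translates RU lU FU) (FV_translates : translates RV lV FV)
    (UV_disjoint : (U `&` V = set0)%classic)
    (short_proofs : short_disjointness_proofs P lU lV FU FV)
    (hardness : hard_to_distinguish R U V) :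
  ~ KPT_interpolation P.
Proof.
case=> k [f [k_gt0 f_poly kpt]].
have [lU_poly FU_poly] := translation_poly FU_translates.
have [lV_poly FV_poly] := translation_poly FV_translates.
have FU_cnf := cnf_of_translation FU_translates.
have FV_cnf := cnf_of_translation FV_translates.
(* Each round needs a string of its own, and width 4 accommodates a 3-clause with its guard. *)
pose w := k + 4; have w_ge4 : 4 <= w by rewrite leq_addl.
have kw : k <= w by rewrite leq_addr.
have [B [B_poly refutation]] := premises_refuted lU_poly lV_poly FU_poly FV_poly
  P_contains short_proofs FU_cnf FV_cnf w_ge4.
have [c circ] := student_circuits (2 ^ w) f_poly.
pose Y n := ysize w (lU n) (lV n).
(* [Z] bounds the length of the displayed proof, [L] that of the code of a student's input: two
   strings and fewer than [k] answers. *)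
pose Z n := ((2 + 2 * 2 ^ w) *
  (2 * part_bound w n (lU n) (lV n) (FU n) (FV n) (B n)).+2).+1.
pose L n := ((2 + k) * (2 * (w * n + Z n + Y n)).+2).+1.
pose E n := (L n).+2 ^ c.
have E_poly : poly_bounded E.
  have pc := poly_bounded_const; have pS := poly_bounded_S.
  have Y_poly : poly_bounded Y := ysize_poly w lU_poly lV_poly.
  have xs_poly : poly_bounded (fun n => w * n) by apply: poly_bounded_mul (pc w) poly_bounded_id.
  have Z_poly : poly_bounded Z.
    apply: (pS); apply: poly_bounded_mul (pc _) _; do 2!apply: (pS).
    apply: poly_bounded_mul (pc 2) _; rewrite /part_bound.
    apply: poly_bounded_add.
      apply: poly_bounded_add => //; do 2!apply: (pS).
      exact: form_bound_poly.
    apply: (pS); apply: poly_bounded_mul; first exact: poly_bounded_add.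
    by do 2!apply: (pS); apply: natoms_poly.
  apply: poly_bounded_exp; do 3!apply: (pS); apply: poly_bounded_mul (pc _) _.
  do 2!apply: (pS); apply: poly_bounded_mul (pc 2) _.
  by do 2!apply: poly_bounded_add => //.
have [c0 costP] := poly_bounded_expn (predictor_cost_poly w k E_poly).
(* A single length suffices: hardness applies from [n0] on, and [2 ^ k.+2] makes the advantage small
   enough. The successor in [c0.+1] makes the exponent positive. *)
have [n0 /(_ (maxn n0 (2 ^ k.+2)) (leq_maxl _ _))] := hardness c0.+1 isT.
set n := maxn _ _; case=> D [distD []].
have kn : 2 ^ k.+2 <= n := leq_maxr _ _.
have n_gt1 : 1 < n by apply: leq_trans kn; rewrite -[2]/(2 ^ 1) leq_exp2l.
have [cnfU atU] := FU_cnf n; have [cnfV atV] := FV_cnf n.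
have [pi piP piB] := refutation n.
have [eps_ge0 eps_lt] := inverse_power_small R kn (ltn0Sn c0).
have [|||||C [wfC sC advC]] := student_distinguishes (f := f) (E := E n)
  (z := displayed_proof pi (xvars w n) (display w n (lU n) (lV n) (FU n) (FV n)))
  cnfU cnfV atU atV _ _ _ k_gt0 kw _ _ distD eps_ge0 eps_lt; last first.
- exists C; split=> //; apply: leq_trans sC (leq_trans (costP n n_gt1) _).
  by rewrite leq_exp2l.
- by move=> al wit x0 l sl; apply: kpt_interpolated kpt piP sl.
- move=> j a1 a2 ws i jk sa sws wsP iw; apply: circ => //; first exact: ltnW.
  apply: leq_trans (size_enc_strs_le (M := w * n + Z n + Y n) _) _.
    move=> s; rewrite !inE => /or3P[/eqP->|/eqP->|/wsP->].
    + by rewrite !size_cat size_nseq addnA sa -addnA leq_addr.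
    + have := size_displayed_proof w n (lU n) (lV n) cnfU cnfV piB.
      by rewrite -/(Z n) => /leq_trans; apply; lia.
    by rewrite leq_addl.
  by rewrite /L ltnS leq_mul2r /= !ltnS ltnW.
- by move=> x Vx; apply: membership_witness V_NP FV_translates _ Vx; rewrite size_tuple.
- by move=> x Ux; apply: membership_witness U_NP FU_translates _ Ux; rewrite size_tuple.
by move=> x Ux Vx; have : (U `&` V)%classic x by []; rewrite UV_disjoint.
Qed.
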